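(* Let $(A,X)$ be a primitive axial algebra of Jordan type $\tfrac12$ over a field $\mathbb{F}$ with $\operatorname{char}\mathbb{F}\neq 2$, let $a,b\in X$ with $a\neq b$, and suppose that the subalgebra $\langle\!\langle a,b\rangle\!\rangle$ of $A$ generated by $a$ and $b$ is not solid. Then $\langle\!\langle a,b\rangle\!\rangle$ contains precisely $3$ elements that are primitive $\mathcal{J}(\tfrac12)$-axes of $A$.
   Context: Algebras are commutative but not necessarily associative. For an algebra $A$ over a field $\mathbb{F}$ ($\operatorname{char}\mathbb{F}\ne2$), $a\in A$ and $\lambda\in\mathbb{F}$, put $A_\lambda(a)=\{x\in A: ax=\lambda x\}$. A nonzero idempotent $a\in A$ is a $\mathcal{J}(\tfrac12)$-axis if $A=A_1(a)\oplus A_0(a)\oplus A_{1/2}(a)$ and $A_1(a)A_1(a)\subseteq A_1(a)$, $A_0(a)A_0(a)\subseteq A_0(a)$, $A_1(a)A_0(a)=0$, $A_1(a)A_{1/2}(a)\subseteq A_{1/2}(a)$, $A_0(a)A_{1/2}(a)\subseteq A_{1/2}(a)$, $A_{1/2}(a)A_{1/2}(a)\subseteq A_1(a)\oplus A_0(a)$. It is primitive if $A_1(a)=\mathbb{F}a$. A primitive axial algebra of Jordan type $\tfrac12$ is a pair $(A,X)$ where $X\subset A$ is a set of primitive $\mathcal{J}(\tfrac12)$-axes generating $A$ as an algebra. A primitive idempotent of an algebra $B$ over a field $\mathbb{K}$ is a nonzero idempotent $c\in B$ with $\{x\in B: cx=x\}=\mathbb{K}c$. For $a\neq b$ in $X$,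 the subalgebra $B=\langle\!\langle a,b\rangle\!\rangle$ is solid if, for an (equivalently every) algebraic closure $\mathbb{E}$ of $\mathbb{F}$, every primitive idempotent of $B\otimes_{\mathbb{F}}\mathbb{E}$ is a $\mathcal{J}(\tfrac12)$-axis of $A\otimes_{\mathbb{F}}\mathbb{E}$. *)

(* Defs.v *)
From HB Require Import structures.
From mathcomp Require Import all_boot all_order all_algebra.
From mathcomp Require Import boolp classical_sets cardinality.

Set Implicit Arguments.
Unset Strict Implicit.
Unset Printing Implicit Defensive.

Import GRing.Theory.
Local Open Scope classical_set_scope.
Local Open Scope quotient_scope.
Local Open Scope ring_scope.

Reserved Notation "x ** y" (at level 40, left associativity).

(* Neither associativity nor a unit is required. *)
HB.mixin Record Lmodule_isCommNAAlgebra (F : fieldType) A of GRing.Lmodule F A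
  := {
  namul : A -> A -> A;
  namulC : commutative namul;
  namulDl : left_distributive namul +%R;
  namulZl : forall (k : F) (x y : A), namul (k *: x) y = k *: namul x y
}.

#[short(type="commNAAlgType")]
HB.structure Definition CommNAAlgebra (F : fieldType) :=
  {A of GRing.Lmodule F A & Lmodule_isCommNAAlgebra F A}.

Notation "x ** y" := (namul x y) : ring_scope.

(** Extension of scalars along a field morphism [iota : F -> E].  An element of
    [A (x)_F E] is a formal sum of pairs [(a, e)] modulo the least congruence
    (for concatenation) containing the relations that define a tensor
    product. *)

Section ScalarExtension.
Variables (F E : fieldType) (iota : {rmorphism F -> E}).

Section Module.
Variable A : lmodType F.
Implicit Types (s t : seq (A * E)) (a b : A) (e f : E).

Inductive tensor_rel : seq (A * E) -> seq (A * E) -> Prop :=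
| tensor_refl s : tensor_rel s s
| tensor_sym s t : tensor_rel s t -> tensor_rel t s
| tensor_trans s t u : tensor_rel s t -> tensor_rel t u -> tensor_rel s u
| tensor_cat s s' t t' :
    tensor_rel s s' -> tensor_rel t t' -> tensor_rel (s ++ t) (s' ++ t')
| tensor_comm s t : tensor_rel (s ++ t) (t ++ s)
| tensor_zero : tensor_rel [:: (0, 0)] [::]
| tensor_addl a b e : tensor_rel [:: (a + b, e)] [:: (a, e); (b, e)]
| tensor_addr a e f : tensor_rel [:: (a, e + f)] [:: (a, e); (a, f)]
| tensor_scale (k : F) a e :
    tensor_rel [:: (k *: a, e)] [:: (a, iota k * e)].

Let relb s t := `[< tensor_rel s t >].

Lemma tensor_rel_equiv : equiv_class_of relb.
Proof.
split.
- by move=> s; apply/asboolP; exact: tensor_refl.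
- by move=> s t; apply/asboolP/asboolP => /tensor_sym.
- move=> t s u /asboolP st /asboolP tu; apply/asboolP.
  exact: tensor_trans st tu.
Qed.

Canonical tensor_equiv := EquivRelPack tensor_rel_equiv.

Definition scalar_ext := {eq_quot tensor_equiv}.
HB.instance Definition _ := Choice.on scalar_ext.

Implicit Types x y z : scalar_ext.

Definition formal_sum s : scalar_ext := \pi_scalar_ext s.
Definition tensor a e : scalar_ext := formal_sum [:: (a, e)].

Lemma formal_sumP s t : formal_sum s = formal_sum t <-> tensor_rel s t.
Proof.
split; first by move=> /eqmodP /asboolP.
by move=> st; apply/eqmodP/asboolP.
Qed.

Lemma formal_sum_repr x : formal_sum (repr x) = x.
Proof. by rewrite /formal_sum reprK. Qed.

Lemma repr_formal_sum s : tensor_rel (repr (formal_sum s)) s.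
Proof. by apply/formal_sumP; rewrite formal_sum_repr. Qed.

Lemma scalar_ext_ind (P : scalar_ext -> Prop) :
  (forall s, P (formal_sum s)) -> forall x, P x.
Proof. by move=> H x; rewrite -(formal_sum_repr x). Qed.

Lemma tensor_perm s t : perm_eq s t -> tensor_rel s t.
Proof.
elim: s t => [|p s IHs] t.
  by move=> /perm_size/esym/size0nil->; exact: tensor_refl.
move=> pst; have pt : p \in t by rewrite -(perm_mem pst) mem_head.
case/path.splitPr: pt pst => t1 t2 pst.
have st : perm_eq s (t1 ++ t2).
  by rewrite -(perm_cons p) (permPl pst) perm_catC /= perm_cons perm_catC.
have pst1 : tensor_rel (p :: s) (p :: t1 ++ t2).
  exact: (tensor_cat (tensor_refl [:: p]) (IHs _ st)).
apply: (tensor_trans pst1).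
rewrite -[p :: _]/(([:: p] ++ t1) ++ t2) -[p :: t2]cat1s [X in tensor_rel _ X]catA.
exact: tensor_cat (tensor_comm _ _) (tensor_refl _).
Qed.

Lemma tensor_zeror a : tensor_rel [:: (a, 0)] [::].
Proof.
have := tensor_scale 0 a 0; rewrite scale0r rmorph0 mul0r => H.
exact: tensor_trans (tensor_sym H) tensor_zero.
Qed.

Definition scale_sum e s := [seq (p.1, e * p.2) | p <- s].

Lemma scale_sum_rel e s t :
  tensor_rel s t -> tensor_rel (scale_sum e s) (scale_sum e t).
Proof.
elim=> {s t}.
- by move=> s; exact: tensor_refl.
- by move=> s t _; exact: tensor_sym.
- by move=> s t u _ st _ tu; exact: tensor_trans st tu.
- by move=> s s' t t' _ ss' _ tt'; rewrite /scale_sum !map_cat; exact: tensor_cat.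
- by move=> s t; rewrite /scale_sum !map_cat; exact: tensor_comm.
- by rewrite /= mulr0; exact: tensor_zero.
- by move=> a b f; exact: tensor_addl.
- by move=> a f g; rewrite /= mulrDr; exact: tensor_addr.
- by move=> k a f; rewrite /= mulrCA; exact: tensor_scale.
Qed.

Definition ext_add x y := formal_sum (repr x ++ repr y).
Definition ext_scale e x := formal_sum (scale_sum e (repr x)).

Lemma ext_addE s t :
  ext_add (formal_sum s) (formal_sum t) = formal_sum (s ++ t).
Proof. by apply/formal_sumP; apply: tensor_cat; exact: repr_formal_sum. Qed.

Lemma ext_scaleE e s :
  ext_scale e (formal_sum s) = formal_sum (scale_sum e s).
Proof. by apply/formal_sumP/scale_sum_rel/repr_formal_sum. Qed.

Lemma ext_addA : associative ext_add.
Proof.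
elim/scalar_ext_ind=> s; elim/scalar_ext_ind=> t; elim/scalar_ext_ind=> u.
by rewrite !ext_addE catA.
Qed.

Lemma ext_addC : commutative ext_add.
Proof.
elim/scalar_ext_ind=> s; elim/scalar_ext_ind=> t.
by rewrite !ext_addE; apply/formal_sumP; exact: tensor_comm.
Qed.

Lemma ext_add0 : left_id (formal_sum [::]) ext_add.
Proof. by elim/scalar_ext_ind=> s; rewrite ext_addE. Qed.

Lemma ext_scaleDl x :
  {morph ext_scale^~ x : e f / e + f >-> ext_add e f}.
Proof.
elim/scalar_ext_ind: x => s e f /=.
rewrite !ext_scaleE ext_addE; apply/formal_sumP.
elim: s => [|[a g] s IHs]; first exact: tensor_refl.
rewrite /= mulrDl -cat1s.
apply: (tensor_trans (tensor_cat (tensor_addr _ _ _) IHs)).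
apply: tensor_perm; rewrite /= perm_cons.
by rewrite perm_sym perm_catC /= perm_cons perm_catC.
Qed.

Lemma ext_scale0 x : ext_scale 0 x = formal_sum [::].
Proof.
elim/scalar_ext_ind: x => s; rewrite ext_scaleE; apply/formal_sumP.
elim: s => [|[a g] s IHs]; first exact: tensor_refl.
by rewrite /= mul0r -cat1s; exact: (tensor_cat (tensor_zeror a) IHs).
Qed.

Lemma ext_scale1 : left_id 1 ext_scale.
Proof.
elim/scalar_ext_ind=> s; rewrite ext_scaleE /scale_sum.
congr formal_sum; rewrite -[RHS]map_id.
by apply: eq_map => -[a e] /=; rewrite mul1r.
Qed.

Lemma ext_addN : left_inverse (formal_sum [::]) (ext_scale (-1)) ext_add.
Proof.
by move=> x; rewrite -[X in ext_add _ X]ext_scale1 -ext_scaleDl addNr ext_scale0.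
Qed.

HB.instance Definition _ :=
  GRing.isZmodule.Build scalar_ext ext_addA ext_addC ext_add0 ext_addN.

Lemma ext_scaleA e f x : ext_scale e (ext_scale f x) = ext_scale (e * f) x.
Proof.
elim/scalar_ext_ind: x => s; rewrite !ext_scaleE /scale_sum -map_comp.
by congr formal_sum; apply: eq_map => -[a g] /=; rewrite mulrA.
Qed.

Lemma ext_scaleDr : right_distributive ext_scale +%R.
Proof.
move=> e; elim/scalar_ext_ind=> s; elim/scalar_ext_ind=> t.
by rewrite [_ + _]ext_addE !ext_scaleE [RHS]ext_addE /scale_sum map_cat.
Qed.

HB.instance Definition _ := GRing.Zmodule_isLmodule.Build E scalar_ext
  ext_scaleA ext_scale1 ext_scaleDr ext_scaleDl.

Lemma scalar_extP x : exists s, x = \sum_(p <- s) p.2 *: tensor p.1 1.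
Proof.
elim/scalar_ext_ind: x => s; exists s.
elim: s => [|[a e] s IHs]; first by rewrite big_nil.
rewrite big_cons -IHs [e *: _]ext_scaleE [RHS]ext_addE /=.
by rewrite mulr1.
Qed.

Lemma scalar_ext_lift (M : lmodType E) (phi : A -> M) :
  (forall a b, phi (a + b) = phi a + phi b) ->
  (forall k a, phi (k *: a) = iota k *: phi a) ->
  exists g : {linear scalar_ext -> M}, forall a e, g (tensor a e) = e *: phi a.
Proof.
move=> phiD phiZ; pose ev s := \sum_(p <- s) p.2 *: phi p.1.
have evP s t : tensor_rel s t -> ev s = ev t.
  elim=> {s t}; rewrite /ev.
  - by [].
  - by [].
  - by move=> s t u _ -> _ ->.
  - by move=> s s' t t' _ ss' _ tt'; rewrite !big_cat ss' tt'.
  - by move=> s t; rewrite !big_cat /= addrC.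
  - by rewrite big_seq1 big_nil scale0r.
  - by move=> a b e; rewrite !(big_cons, big_nil) !addr0 phiD scalerDr.
  - by move=> a e f; rewrite !(big_cons, big_nil) !addr0 scalerDl.
  - by move=> k a e; rewrite !big_seq1 phiZ scalerA mulrC.
pose g x := ev (repr x).
have gE s : g (formal_sum s) = ev s by apply/evP/repr_formal_sum.
have gL : linear g.
  move=> e; elim/scalar_ext_ind=> s; elim/scalar_ext_ind=> t.
  rewrite [e *: _]ext_scaleE [_ + _]ext_addE !gE /ev big_cat big_map.
  by rewrite scaler_sumr; congr (_ + _); apply: eq_bigr => p _; rewrite scalerA.
pose gM := GRing.isLinear.Build _ _ _ _ g gL.
pose gG : {linear scalar_ext -> M} := HB.pack g gM.
by exists gG => a e; rewrite [LHS]gE /ev big_seq1.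
Qed.

End Module.

Section Algebra.
Variable A : commNAAlgType F.
Implicit Types (s t : seq (A * E)) (x y z : scalar_ext A).

Definition mul_sum s t := [seq (p.1 ** q.1, p.2 * q.2) | p <- s, q <- t].

Lemma mul_sumC s t : tensor_rel (mul_sum s t) (mul_sum t s).
Proof.
elim: t => [|q t IHt].
  by rewrite /mul_sum; elim: s => //=; exact: tensor_refl.
have := perm_allpairs_consr (fun p q : A * E => (p.1 ** q.1, p.2 * q.2))
  s (fun=> q) (fun=> t).
move=> /permPl /tensor_perm /tensor_trans; apply.
apply: tensor_cat IHt.
have -> : [seq (p.1 ** q.1, p.2 * q.2) | p <- s]
        = [seq (q.1 ** p.1, q.2 * p.2) | p <- s].
  by apply: eq_map => p; rewrite namulC mulrC.
exact: tensor_refl.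
Qed.

Lemma mul_sum_rel s s' t :
  tensor_rel s s' -> tensor_rel (mul_sum s t) (mul_sum s' t).
Proof.
have red (u v : seq (A * E)) :
    (forall q, tensor_rel (mul_sum u [:: q]) (mul_sum v [:: q])) ->
  tensor_rel (mul_sum u t) (mul_sum v t).
  move=> H; apply: (tensor_trans (mul_sumC _ _)).
  apply: tensor_sym; apply: (tensor_trans (mul_sumC _ _)); apply: tensor_sym.
  elim: t => [|q t IHt]; first exact: tensor_refl.
  apply: tensor_cat IHt; have := H q.
  move=> /(tensor_trans (mul_sumC [:: q] u)) /tensor_trans /(_ (mul_sumC _ _)).
  by rewrite /mul_sum /= !cats0.
elim=> {s s'}.
- by move=> s; exact: tensor_refl.
- by move=> s s' _; exact: tensor_sym.
- by move=> s s' u _ H _; exact: tensor_trans H.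
- by move=> s s' u u' _ H _ K; rewrite /mul_sum !allpairs_cat; exact: tensor_cat.
- by move=> s s'; rewrite /mul_sum !allpairs_cat; exact: tensor_comm.
- by apply: red => q; rewrite /mul_sum /= mul0r; exact: tensor_zeror.
- move=> a b e; apply: red => q; rewrite /mul_sum /= namulDl; exact: tensor_addl.
- move=> a e f; apply: red => q; rewrite /mul_sum /= mulrDl; exact: tensor_addr.
- move=> k a e; apply: red => q; rewrite /mul_sum /= namulZl -mulrA.
  exact: tensor_scale.
Qed.

Definition ext_mul x y := formal_sum (mul_sum (repr x) (repr y)).

Lemma ext_mulE s t :
  ext_mul (formal_sum s) (formal_sum t) = formal_sum (mul_sum s t).
Proof.
apply/formal_sumP.
apply: (tensor_trans (mul_sum_rel _ (repr_formal_sum _ ))).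
apply: (tensor_trans (mul_sumC _ _)).
apply: (tensor_trans (mul_sum_rel _ (repr_formal_sum _ ))).
exact: mul_sumC.
Qed.

Lemma ext_mulC : commutative ext_mul.
Proof.
elim/scalar_ext_ind=> s; elim/scalar_ext_ind=> t.
by rewrite !ext_mulE; apply/formal_sumP; exact: mul_sumC.
Qed.

Lemma ext_mulDl : left_distributive ext_mul +%R.
Proof.
elim/scalar_ext_ind=> s; elim/scalar_ext_ind=> t; elim/scalar_ext_ind=> u.
by rewrite [_ + _]ext_addE !ext_mulE [RHS]ext_addE /mul_sum allpairs_cat.
Qed.

Lemma ext_mulZl e x y : ext_mul (e *: x) y = e *: ext_mul x y.
Proof.
elim/scalar_ext_ind: x => s; elim/scalar_ext_ind: y => t.
rewrite [e *: _]ext_scaleE !ext_mulE [RHS]ext_scaleE; congr formal_sum.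
rewrite /mul_sum /scale_sum allpairs_mapl map_allpairs.
by apply: eq_allpairs => p q /=; rewrite mulrA.
Qed.

HB.instance Definition _ := Lmodule_isCommNAAlgebra.Build E (scalar_ext A)
  ext_mulC ext_mulDl ext_mulZl.

Lemma mul_tensor (a b : A) (e f : E) :
  tensor a e ** tensor b f = tensor (a ** b) (e * f).
Proof. exact: ext_mulE. Qed.

End Algebra.
End ScalarExtension.

Section Axes.
Variables (F : fieldType) (A : commNAAlgType F).
Implicit Types (X B : set A) (a b c x : A).

Definition eigenspace_of a (l : F) : set A := [set x | a ** x = l *: x].

Local Notation half := (2%:R^-1).

(* [A_1 + A_0], the sum being direct by [axis_decomposition] below. *)
Definition even_part a : set A :=
  [set x | exists u v, [/\ eigenspace_of a 1 u, eigenspace_of a 0 v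
                         & x = u + v]].

Definition axis_decomposition a : Prop :=
  forall x, exists! p : A * A * A,
    [/\ eigenspace_of a 1 p.1.1, eigenspace_of a 0 p.1.2,
        eigenspace_of a half p.2 & x = p.1.1 + p.1.2 + p.2].

Record jordan_half_axis a : Prop := JordanHalfAxis {
  axis_neq0 : a != 0;
  axis_idem : a ** a = a;
  axis_decomp : axis_decomposition a;
  axis_fusion11 : forall x y, eigenspace_of a 1 x -> eigenspace_of a 1 y ->
    eigenspace_of a 1 (x ** y);
  axis_fusion00 : forall x y, eigenspace_of a 0 x -> eigenspace_of a 0 y ->
    eigenspace_of a 0 (x ** y);
  axis_fusion10 : forall x y, eigenspace_of a 1 x -> eigenspace_of a 0 y ->
    x ** y = 0;
  axis_fusion1h : forall x y, eigenspace_of a 1 x -> eigenspace_of a half y ->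
    eigenspace_of a half (x ** y);
  axis_fusion0h : forall x y, eigenspace_of a 0 x -> eigenspace_of a half y ->
    eigenspace_of a half (x ** y);
  axis_fusionhh : forall x y, eigenspace_of a half x -> eigenspace_of a half y ->
    even_part a (x ** y)
}.

Definition line a : set A := [set x | exists k : F, x = k *: a].

Definition primitive_axis a : Prop :=
  jordan_half_axis a /\ eigenspace_of a 1 = line a.

Record is_subalgebra B : Prop := IsSubalgebra {
  subalgebra0 : B 0;
  subalgebraD : forall x y, B x -> B y -> B (x + y);
  subalgebraZ : forall (k : F) x, B x -> B (k *: x);
  subalgebraM : forall x y, B x -> B y -> B (x ** y)
}.

Definition generated X : set A := smallest is_subalgebra X.

Definition primitive_idempotent_in B c : Prop :=
  [/\ B c, c != 0, c ** c = c & [set x | B x /\ c ** x = x] = line c].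

Definition primitive_axial_algebra X : Prop :=
  (forall a, X a -> primitive_axis a) /\ generated X = setT.

End Axes.

(* The image of [B (x)_F E] in [A (x)_F E]; since [E] is free over [F], the
   canonical map is injective and this image is [B (x)_F E] itself. *)
Definition ext_subalgebra (F E : fieldType) (iota : {rmorphism F -> E})
    (A : commNAAlgType F) (B : set A) : set (scalar_ext iota A) :=
  [set x | exists s : seq (A * E),
    (forall p, p \in s -> B p.1) /\ x = \sum_(p <- s) tensor iota p.1 p.2].

Arguments ext_subalgebra {F E} iota {A} B.

Definition solid (F : fieldType) (A : commNAAlgType F) (B : set A) : Prop :=
  forall (E : closedFieldType) (iota : {rmorphism F -> E}),
    (forall z : E, algebraicOver iota z) ->
    forall c : scalar_ext iota A,
      primitive_idempotent_in (ext_subalgebra iota B) c -> jordan_half_axis c.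

(* Main.v *)
Require Import Defs.
From mathcomp Require Import all_boot all_order all_algebra.
From mathcomp Require Import boolp classical_sets cardinality.
From mathcomp Require Import ring.

(** A primitive axis [c] comes with a linear form [f], the coefficient along
    [c], and the axioms of a primitive axis amount to identities in [c] and [f]:
    the Peirce identity [2 c(cx) = cx + f(x) c] and the statement that the
    Miyamoto involution [1 - 4 L_c + 4 f(.) c] is an automorphism.  The axes span
    [A], whence the Frobenius form [B] with [B c = f], and after the Peirce
    identity is used the second condition, too, becomes quadratic in [c].  So
    solidity of [<<a, b>>] asks two quadratic maps (the diagonals of the bilinear
    maps [peirce] and [defect]) to vanish on the conic of primitive idempotents
    of [<<a, b>>], which is spanned by [a], [b] and [s = ab - a/2 - b/2].

    A quadratic map vanishes on the conic as soon as its polarisation [q]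
    satisfies [q a s = q b s = r], [q a b = - 2 r] and [q s s = 2 p r], where
    [a s = p a], [2 p = B a b - 1].  For [peirce] this follows from the fusion rules
    of [a] and [b] and from the commutation of [L_s] with [L_a] and [L_b].
    For [defect], evaluating at the reflections of [a] and [b] gives
    [(4 B a b - 1) (q a s - q b s) = 0], then the value of [q s s], and
    [(2 B a b - 1) (q a b + 2 r) = 0].  The case [B a b = 1/2] is settled by a
    separate computation on the orthogonal complement of [<<a, b>>].
    Hence a subalgebra that is not solid has [B a b = 1/4].  In this case [a],
    [b] and the reflection of [a] in [b] are axes, while a fourth axis on the
    conic, together with its images under the involutions of [a] and [b], would
    again force [defect] to vanish on the conic. *)

Set Implicit Arguments.
Unset Strict Implicit.
Unset Printing Implicit Defensive.

Import GRing.Theory.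
Local Open Scope classical_set_scope.
Local Open Scope card_scope.
Local Open Scope ring_scope.

(** * Linear combinations in a vector space *)

Inductive lin_expr (K : Type) :=
  | LZero | LAtom of nat | LAdd of lin_expr K & lin_expr K
  | LOpp of lin_expr K | LScale of K & lin_expr K.
Arguments LZero {K}.
Arguments LAtom {K}.

Section LinExpr.
Variables (K : fieldType) (V : lmodType K).

Fixpoint lin_eval (env : seq V) (t : lin_expr K) : V :=
  match t with
  | LZero => 0 | LAtom i => nth 0 env i
  | LAdd t u => lin_eval env t + lin_eval env u
  | LOpp t => - lin_eval env t | LScale k t => k *: lin_eval env t
  end.

(** [eqn] and a plain [if] let [cbn] reduce coefficients to bare field expressions, fit for [ring]
    and [field]. *)
Fixpoint lin_coef (i : nat) (t : lin_expr K) : K :=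
  match t with
  | LZero => 0 | LAtom j => if eqn j i then 1 else 0
  | LAdd t u => lin_coef i t + lin_coef i u
  | LOpp t => - lin_coef i t | LScale k t => k * lin_coef i t
  end.

Fixpoint same_coefs (n : nat) (t u : lin_expr K) : Prop :=
  if n is m.+1 then lin_coef m t = lin_coef m u /\ same_coefs m t u else True.

Lemma lin_evalE env t :
  lin_eval env t = \sum_(i < size env) lin_coef i t *: env`_i.
Proof.
elim: t => [|j|t IHt u IHu|t IHt|k t IHt]; rewrite [LHS]/=.
- by rewrite big1 // => i _; rewrite scale0r.
- have coefE i : lin_coef i (LAtom j) = if j == i then 1 else 0 :> K by [].
  have [ltj|gej] := ltnP j (size env).
    rewrite (bigD1 (Ordinal ltj)) //= -/(lin_coef j (LAtom j)) coefE eqxx scale1r.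
    rewrite big1 ?addr0 // => i; rewrite -val_eqE -/(lin_coef i (LAtom j)) coefE /=.
    by move=> /negPf ni; rewrite eq_sym ni scale0r.
  rewrite nth_default // big1 // => i _; rewrite coefE.
  by rewrite gtn_eqF ?scale0r // (leq_trans (ltn_ord i)).
- by rewrite IHt IHu -big_split; apply: eq_bigr => i _; rewrite scalerDl.
- by rewrite IHt -sumrN; apply: eq_bigr => i _; rewrite scaleNr.
- by rewrite IHt scaler_sumr; apply: eq_bigr => i _; rewrite scalerA.
Qed.

Lemma lin_eval_eq env t u :
  same_coefs (size env) t u -> lin_eval env t = lin_eval env u.
Proof.
rewrite !lin_evalE => H; apply: eq_bigr => -[i lti] _ /=; congr (_ *: _).
elim: (size env) i lti H => // n IHn i; rewrite ltnS leq_eqVlt => /orP[/eqP->|].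
  by case.
by move=> lti [_]; exact: IHn.
Qed.

End LinExpr.

Ltac lin_index env x :=
  lazymatch env with
  | cons ?y ?e => match constr:(tt) with
    | _ => let _ := match constr:(tt) with _ => constr_eq x y end in constr:(0%N)
    | _ => let i := lin_index e x in constr:(S i)
    end
  end.
Ltac lin_mem env x :=
  lazymatch env with
  | nil => constr:(false)
  | cons ?y ?e => match constr:(tt) with
    | _ => let _ := match constr:(tt) with _ => constr_eq x y end in constr:(true)
    | _ => lin_mem e x
    end
  end.
Ltac lin_atoms env t :=
  lazymatch t with
  | GRing.zero => env
  | GRing.add ?x ?y => let env := lin_atoms env x in lin_atoms env y
  | GRing.opp ?x => lin_atoms env x
  | GRing.scale _ ?x => lin_atoms env x
  | _ => lazymatch lin_mem env t with
         | true => env | false => constr:(cons t env) end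
  end.
Ltac lin_reify K env t :=
  lazymatch t with
  | GRing.zero => constr:(@LZero K)
  | GRing.add ?x ?y => let x' := lin_reify K env x in
      let y' := lin_reify K env y in constr:(LAdd x' y')
  | GRing.opp ?x => let x' := lin_reify K env x in constr:(LOpp x')
  | GRing.scale ?k ?x => let x' := lin_reify K env x in constr:(LScale (k : K) x')
  | _ => let i := lin_index env t in constr:(@LAtom K i)
  end.
(* Reduces an equality of linear combinations in a vector space to the
   equalities of the coefficients of its atoms. *)
Ltac lin_coefs K :=
  lazymatch goal with |- @eq ?V ?x ?y =>
    let env := lin_atoms (@nil V) x in
    let env := lin_atoms env y in
    let t := lin_reify K env x in
    let u := lin_reify K env y in
    change (lin_eval env t = lin_eval env u);
    apply: lin_eval_eq;
    cbn [same_coefs lin_coef size eqn]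
  end.
Ltac lin_by K tac := lin_coefs K; repeat (split; [tac|]); exact I.

(** * Primitive axes as solutions of identities *)

Section Bilinear.
Variables (K : fieldType) (A : commNAAlgType K).
Implicit Types (x y z : A) (k : K).

Lemma namulDr x y z : x ** (y + z) = x ** y + x ** z.
Proof. by rewrite namulC namulDl !(namulC _ x). Qed.

Lemma namulZr k x y : x ** (k *: y) = k *: (x ** y).
Proof. by rewrite namulC namulZl namulC. Qed.

Lemma namul0l x : 0 ** x = 0.
Proof. by rewrite -(scale0r (0 : A)) namulZl !scale0r. Qed.

Lemma namul0r x : x ** 0 = 0.
Proof. by rewrite namulC namul0l. Qed.

Lemma namulNl x y : (- x) ** y = - (x ** y).
Proof. by rewrite -scaleN1r namulZl scaleN1r. Qed.

Lemma namulNr x y : x ** (- y) = - (x ** y).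
Proof. by rewrite namulC namulNl namulC. Qed.

Definition namE :=
  (@namulDl K A, namulDr, @namulZl K A, namulZr, namulNl, namulNr, namul0l, namul0r).

Record linear_form (f : A -> K) : Prop := LinearForm {
  formD : forall x y, f (x + y) = f x + f y;
  formZ : forall k x, f (k *: x) = k * f x
}.

Lemma form0 f : linear_form f -> f 0 = 0.
Proof. by move=> fL; rewrite -(scale0r (0 : A)) formZ // mul0r. Qed.

Lemma formN f x : linear_form f -> f (- x) = - f x.
Proof. by move=> fL; rewrite -scaleN1r formZ // mulN1r. Qed.

Definition formE f (fL : linear_form f) :=
  (formD fL, formZ fL, fun x => @formN f x fL, form0 fL).

(* [f] is the projection on the axis, [x = f x *: c + x_0 + x_(1/2)]. In its
   presence the Peirce decomposition amounts to [axis_peirce], while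
   [axis_fusion] and [axis_assoc] express that the Miyamoto involution
   [x - 4 cx + 4 (f x) c] is an automorphism and that [c] is orthogonal to
   [A_0(c) A_0(c)]. *)
Record axis_form (c : A) (f : A -> K) : Prop := AxisForm {
  axis_linear : linear_form f;
  axis_nz : c != 0;
  axis_idemp : c ** c = c;
  axis_peirce : forall x,
    c ** (c ** x) = 2%:R^-1 *: (c ** x) + (2%:R^-1 * f x) *: c;
  axis_fusion : forall x y,
    c ** (x ** y) = f (x ** y) *: c + (c ** x) ** y + x ** (c ** y)
      - 4%:R *: ((c ** x) ** (c ** y)) + f x *: (c ** y) + f y *: (c ** x);
  axis_assoc : forall x y,
    f ((c ** x) ** y) + f (x ** (c ** y)) = f (x ** y) + f x * f y
}.

End Bilinear.

Section AxisForm.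
Variables (K : fieldType) (A : commNAAlgType K).
Hypothesis two_neq0 : (2%:R : K) != 0.
Implicit Types (x y z c : A) (k : K) (f : A -> K).

Lemma scaler_inj_axis c k l : c != 0 -> k *: c = l *: c -> k = l.
Proof.
move=> c0 /eqP; rewrite -subr_eq0 -scalerBl scaler_eq0 (negPf c0) orbF.
by rewrite subr_eq0 => /eqP.
Qed.

(** [axis_peirce] displays half of [f x] as the coefficient of the nonzero vector [c], so the
    multiplication determines the form. *)
Lemma axis_form_uniq c f g : axis_form c f -> axis_form c g -> f =1 g.
Proof.
move=> cf cg x; have := axis_peirce cf x; rewrite (axis_peirce cg) => /addrI.
move/(scaler_inj_axis (axis_nz cf))/(mulfI _) => -> //.
by rewrite invr_eq0.
Qed.

Lemma axis_form1 c f : axis_form c f -> f c = 1.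
Proof.
move=> cf; have := axis_peirce cf c; rewrite !(axis_idemp cf) -scalerDl.
rewrite -{1}[c]scale1r => /(scaler_inj_axis (axis_nz cf)) e.
have -> : f c = 2%:R * (2%:R^-1 + 2%:R^-1 * f c) - 1 by field.
by rewrite -e; ring.
Qed.

Lemma axis_formM c f x : axis_form c f -> f (c ** x) = f x.
Proof.
move=> cf; have := axis_peirce cf (c ** x).
rewrite {1}(axis_peirce cf x) !namE (axis_idemp cf) => /addrI.
by move=> /(scaler_inj_axis (axis_nz cf))/mulfI-> //; rewrite invr_eq0.
Qed.

(** Each fusion rule is [axis_fusion] evaluated on eigenvectors. What remains is to exclude a
    component along [c]: in [A_0 A_0] this is [axis_assoc], in [A_0 A_(1/2)] it follows by applying
    [f]. *)
Lemma axis_form_primitive c f :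
  axis_form c f -> primitive_axis c.
Proof.
move=> cf; have fL := axis_linear cf; have cc := axis_idemp cf.
have f1 := axis_form1 cf.
have E1 x : c ** x = x -> x = f x *: c.
  move=> cx; have := axis_peirce cf x; rewrite !cx => e.
  have {e} : x - 2%:R^-1 *: x = (2%:R^-1 * f x) *: c by rewrite {1}e addrC addKr.
  move=> e; have xE : x = 2%:R *: (x - 2%:R^-1 *: x) by lin_by K ltac:(by field).
  by rewrite {1}xE e scalerA mulrA divff // mul1r.
have f_0 x : c ** x = 0 -> f x = 0.
  by move=> cx; rewrite -(axis_formM x cf) cx (form0 fL).
have f_h x : c ** x = 2%:R^-1 *: x -> f x = 0.
  move=> cx; have := axis_formM x cf; rewrite cx (formZ fL) => e.
  have -> : f x = 2%:R * (f x - 2%:R^-1 * f x) by field.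
  by rewrite e subrr mulr0.
have e1 : eigenspace_of c 1 = line c.
  apply/seteqP; split=> x; rewrite /eigenspace_of /line /=.
    by rewrite scale1r => /E1 ->; exists (f x).
  by move=> [k ->]; rewrite namE cc scale1r.
have l1 x : eigenspace_of c 1 x -> exists k, x = k *: c by rewrite e1.
have z0 x : eigenspace_of c 0 x -> c ** x = 0.
  by rewrite /eigenspace_of /= scale0r.
have z0' x : c ** x = 0 -> eigenspace_of c 0 x.
  by rewrite /eigenspace_of /= scale0r.
split=> //; split=> //.
- exact: axis_nz cf.
- move=> x.
  (* If [x = k c + v + w] is the Peirce decomposition, then [cx = k c + w/2]; this dictates the half
     component. *)
  pose w := 2%:R *: (c ** x) - (2%:R * f x) *: c.
  have cw : c ** w = 2%:R^-1 *: w.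
    rewrite /w !namE cc (axis_peirce cf); lin_by K ltac:(by field).
  have cv : c ** (x - f x *: c - w) = 0.
    rewrite /w !namE cc (axis_peirce cf); lin_by K ltac:(by field).
  exists ((f x *: c, x - f x *: c - w), w); split => /=.
    split=> //; rewrite ?e1; try by exists (f x).
      exact/z0'.
    lin_by K ltac:(ring).
  move=> [[u v] t] /= [/l1[k ->]] /z0 v0 th xE.
  have fx : f x = k.
    by rewrite xE !(formE fL) f1 (f_0 v) // (f_h t) // !addr0 mulr1.
  have tE : w = t.
    by rewrite /w fx xE !namE cc v0 th; lin_by K ltac:(by field).
  have vE : x - f x *: c - w = v by rewrite tE fx xE; lin_by K ltac:(ring).
  by rewrite vE tE fx.
- move=> x y /l1[k ->] /l1[l ->]; rewrite e1; exists (k * l).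
  rewrite !namE cc; lin_by K ltac:(ring).
- move=> x y /z0 x0 /z0 y0; apply: z0'.
  rewrite (axis_fusion cf) x0 y0 !namE (f_0 x) // (f_0 y) //.
  have := axis_assoc cf x y; rewrite x0 y0 !namE (form0 fL) (f_0 x) //.
  by rewrite mul0r !addr0 => <-; lin_by K ltac:(ring).
- by move=> x y /l1[k ->] /z0 y0; rewrite namE y0 scaler0.
- move=> x y /l1[k ->]; rewrite /eigenspace_of /= => yh.
  by rewrite !namE !yh !namE yh; lin_by K ltac:(ring).
- move=> x y /z0 x0; rewrite /eigenspace_of /= => yh.
  have e : c ** (x ** y) = f (x ** y) *: c + 2%:R^-1 *: (x ** y).
    rewrite (axis_fusion cf) x0 yh !namE (f_0 x) // (f_h y) //.
    lin_by K ltac:(ring).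
  have := congr1 f e; rewrite (axis_formM _ cf) !(formE fL) f1 mulr1.
  move=> /eqP; rewrite -subr_eq0 opprD addrA subrr add0r oppr_eq0 mulf_eq0.
  rewrite invr_eq0 (negPf two_neq0) /= => /eqP f0.
  by rewrite e f0 scale0r add0r.
- move=> x y; rewrite /eigenspace_of /= => xh yh.
  have e : c ** (x ** y) = f (x ** y) *: c.
    rewrite (axis_fusion cf) xh yh !namE (f_h x) // (f_h y) //.
    lin_by K ltac:(by field).
  exists (f (x ** y) *: c), (x ** y - f (x ** y) *: c); split.
  + by rewrite e1; exists (f (x ** y)).
  + by apply: z0'; rewrite !namE cc e subrr.
  + lin_by K ltac:(ring).
Qed.

Lemma primitive_axis_form c : primitive_axis c -> exists f, axis_form c f.
Proof.
move=> [[c0 cc dec f11 f00 f10 f1h f0h fhh] e1].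
have l1 x : eigenspace_of c 1 x -> exists k, x = k *: c by rewrite e1.
have z0 x : eigenspace_of c 0 x <-> c ** x = 0.
  by rewrite /eigenspace_of /= scale0r.
have decE x : exists k, exists v w,
    [/\ x = k *: c + v + w, c ** v = 0 & c ** w = 2%:R^-1 *: w].
  have [[[u v] w] [/= [/l1[k ->] /z0 v0 wh ->] _]] := dec x.
  by exists k, v, w.
have [f fP] := choice decE.
have fE x k v w : x = k *: c + v + w -> c ** v = 0 -> c ** w = 2%:R^-1 *: w ->
    f x = k.
  move=> xE v0 wh; have [v' [w' [xE' v0' wh']]] := fP x.
  apply: (scaler_inj_axis c0).
  (* The polynomial [2 t^2 - t] is 1 at the eigenvalue 1 and 0 at 0 and 1/2, so [2 c(cx) - cx]
     isolates the coefficient of [c]. *)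
  have H k' v1 w1 : x = k' *: c + v1 + w1 -> c ** v1 = 0 ->
      c ** w1 = 2%:R^-1 *: w1 ->
    k' *: c = 2%:R *: (c ** (c ** x)) - c ** x.
    move=> -> v10 w1h; rewrite !namE cc v10 !namE w1h !namE w1h cc.
    by lin_by K ltac:(by field).
  by rewrite (H _ _ _ xE' v0' wh') (H _ _ _ xE v0 wh).
have fL : linear_form f.
  split=> [x y|k x].
    have [v [w [xE v0 wh]]] := fP x; have [v' [w' [yE v0' wh']]] := fP y.
    apply: (fE _ _ (v + v') (w + w')).
    - by rewrite {1}xE {1}yE; lin_by K ltac:(ring).
    - by rewrite namE v0 v0' addr0.
    - by rewrite namE wh wh' scalerDr.
  have [v [w [xE v0 wh]]] := fP x.
  apply: (fE _ _ (k *: v) (k *: w)).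
  - by rewrite {1}xE; lin_by K ltac:(ring).
  - by rewrite namE v0 scaler0.
  - by rewrite namE wh; lin_by K ltac:(ring).
have f1 : f c = 1.
  apply: (fE _ _ 0 0); rewrite ?namE ?scaler0 //; lin_by K ltac:(ring).
have f_0 v : c ** v = 0 -> f v = 0.
  move=> v0; apply: (fE _ _ v 0); rewrite ?namE ?scaler0 //; lin_by K ltac:(ring).
have f_h w : c ** w = 2%:R^-1 *: w -> f w = 0.
  move=> wh; apply: (fE _ _ 0 w); rewrite ?namE //; lin_by K ltac:(ring).
exists f; split=> //.
- move=> x; have [v [w [xE v0 wh]]] := fP x; move: (f x) xE => k xE.
  rewrite xE !namE cc v0 !namE wh !namE wh cc; lin_by K ltac:(by field).
- move=> x y.
  have [v [w [xE v0 wh]]] := fP x; have [v' [w' [yE v0' wh']]] := fP y.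
  have vv : c ** (v ** v') = 0 by apply/z0/f00; apply/z0.
  have vw : c ** (v ** w') = 2%:R^-1 *: (v ** w') by apply: f0h => //; apply/z0.
  have wv : c ** (w ** v') = 2%:R^-1 *: (w ** v').
    by rewrite (namulC w); apply: f0h => //; apply/z0.
  have [m_ [n [/l1[m ->] /z0 n0 ww]]] := fhh _ _ wh wh'.
  have fxy : f (x ** y) = f x * f y + m.
    rewrite {1}xE {1}yE !namE cc v0' wh' (namulC v c) v0 (namulC w c) wh ww.
    rewrite !(formE fL) f1 (f_0 _ vv) (f_h _ vw) (f_h _ wv) (f_0 _ n0) (f_h _ wh).
    by rewrite (f_h _ wh'); ring.
  rewrite fxy; move: (f x) (f y) xE yE => k l xE yE {fxy}.
  rewrite xE yE !namE cc v0 v0' wh wh' !namE (namulC v c) v0 (namulC w c) wh.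
  rewrite !(cc, vv, vw, wv, ww, v0, v0', wh, wh', n0, namE).
  lin_by K ltac:(by field).
- move=> x y.
  have [v [w [xE v0 wh]]] := fP x; have [v' [w' [yE v0' wh']]] := fP y.
  have vv : c ** (v ** v') = 0 by apply/z0/f00; apply/z0.
  have vw : c ** (v ** w') = 2%:R^-1 *: (v ** w') by apply: f0h => //; apply/z0.
  have wv : c ** (w ** v') = 2%:R^-1 *: (w ** v').
    by rewrite (namulC w); apply: f0h => //; apply/z0.
  have [m_ [n [/l1[m ->] /z0 n0 ww]]] := fhh _ _ wh wh'.
  move: (f x) (f y) xE yE => k l -> ->.
  rewrite !namE cc v0 v0' wh wh' !namE (namulC v c) v0 (namulC w c) wh.
  rewrite !(ww, cc, v0', wh', namE).
  rewrite !(formE fL) f1 (f_0 _ vv) (f_h _ vw) (f_h _ wv) (f_0 _ n0) (f_h _ wh).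
  by rewrite (f_h _ wh'); field.
Qed.

End AxisForm.

(** * Miyamoto involutions and the Frobenius form *)

Section Miyamoto.
Variables (K : fieldType) (A : commNAAlgType K).
Hypothesis two_neq0 : (2%:R : K) != 0.
Implicit Types (x y z a b c : A) (k : K) (f g : A -> K).

(** A Seress property. Fusion gives [c(yx) = f(yx) c + y(cx)]; applying [f] yields [f(y(cx)) = 0],
    and this equals [f(yx)] by [axis_assoc]. *)
Lemma axis_annihilator_comm c f x y :
  axis_form c f -> c ** y = 0 -> c ** (y ** x) = y ** (c ** x).
Proof.
move=> cf cy; have fL := axis_linear cf.
have fy : f y = 0 by rewrite -(axis_formM two_neq0 y cf) cy (form0 fL).
have e : c ** (y ** x) = f (y ** x) *: c + y ** (c ** x).
  by rewrite (axis_fusion cf) cy fy !namE; lin_by K ltac:(ring).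
have := axis_assoc cf y x; rewrite cy fy !namE (form0 fL) mul0r add0r addr0.
have := congr1 f e; rewrite (axis_formM two_neq0 _ cf) !(formE fL).
rewrite (axis_form1 two_neq0 cf) => ef f0.
by move: ef; rewrite f0 mulr1 -{1}[f _]addr0 => /addrI f00; rewrite e -f00 scale0r add0r.
Qed.

Definition miyamoto c f x := x - 4%:R *: (c ** x) + (4%:R * f x) *: c.

Section Involution.
Variables (c : A) (f : A -> K).
Hypothesis cf : axis_form c f.
Let fL := axis_linear cf.

Lemma miyamotoD x y : miyamoto c f (x + y) = miyamoto c f x + miyamoto c f y.
Proof. by rewrite /miyamoto !namE !(formE fL); lin_by K ltac:(ring). Qed.

Lemma miyamotoZ k x : miyamoto c f (k *: x) = k *: miyamoto c f x.
Proof. by rewrite /miyamoto !namE !(formE fL); lin_by K ltac:(ring). Qed.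

Lemma miyamotoM x y : miyamoto c f (x ** y) = miyamoto c f x ** miyamoto c f y.
Proof.
rewrite /miyamoto !namE (axis_fusion cf) (axis_idemp cf) (namulC (c ** x) c).
rewrite !(axis_peirce cf) (namulC x c).
by lin_by K ltac:(by field).
Qed.

Lemma miyamotoK : involutive (miyamoto c f).
Proof.
move=> x; rewrite /miyamoto !namE !(formE fL) (axis_formM two_neq0 _ cf).
rewrite (axis_peirce cf) (axis_idemp cf) (axis_form1 two_neq0 cf).
by lin_by K ltac:(by field).
Qed.

End Involution.

Lemma axis_form_aut c f (g : A -> A) :
    (forall x y, g (x + y) = g x + g y) -> (forall k x, g (k *: x) = k *: g x) ->
    (forall x y, g (x ** y) = g x ** g y) -> involutive g ->
  axis_form c f -> axis_form (g c) (f \o g).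
Proof.
move=> gD gZ gM gK cf; have fL := axis_linear cf.
have gN x : g (- x) = - g x by rewrite -scaleN1r gZ scaleN1r.
split=> /=.
- by split=> [x y|k x] /=; rewrite ?gD ?gZ !(formE fL).
- have := axis_nz cf; apply: contra_neq => gc0.
  by rewrite -[c]gK gc0 -(scale0r (0 : A)) gZ !scale0r.
- by rewrite -gM (axis_idemp cf).
- move=> x; rewrite -{1 2}(gK x) -!gM (axis_peirce cf) gD !gZ.
  by rewrite gM gK.
- move=> x y; have -> : g c ** (x ** y) = g (c ** (g x ** g y)) by rewrite !gM !gK.
  rewrite (axis_fusion cf).
  by rewrite !(gD, gZ, gN, gM, gK).
- by move=> x y; rewrite !(gM, gK) (axis_assoc cf).
Qed.

(* Locked, for the expansion of products not to unfold it. *)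
Definition sigma a b := locked (a ** b - 2%:R^-1 *: a - 2%:R^-1 *: b).

Lemma sigmaE a b : sigma a b = a ** b - 2%:R^-1 *: a - 2%:R^-1 *: b.
Proof. by rewrite /sigma -lock. Qed.

Lemma sigmaC a b : sigma a b = sigma b a.
Proof. by rewrite !sigmaE namulC; lin_by K ltac:(ring). Qed.

Lemma mul_sigma a b f :
  axis_form a f -> a ** sigma a b = (2%:R^-1 * (f b - 1)) *: a.
Proof.
move=> af; rewrite sigmaE !namE (axis_peirce af) (axis_idemp af).
by lin_by K ltac:(ring).
Qed.

(** By [mul_sigma], [sigma a b] differs by a multiple of [a] from an element annihilated by [a], to
    which the Seress property applies. *)
Lemma sigma_comm a b f x :
  axis_form a f -> a ** (sigma a b ** x) = sigma a b ** (a ** x).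
Proof.
move=> af; pose p := 2%:R^-1 * (f b - 1).
have := @axis_annihilator_comm a f x (sigma a b - p *: a) af.
rewrite !namE (mul_sigma b af) (axis_idemp af) subrr => /(_ erefl) /addIr.
by [].
Qed.

(** With [s = sigma a b], both [a(sb)] and [b(sa)] equal [s(ab)], so [(f b - 1) ab = (g a - 1) ab].
    If [ab = 0], both values vanish by the Peirce identity. *)
Lemma axis_form_sym a b f g : axis_form a f -> axis_form b g -> f b = g a.
Proof.
move=> af bg.
have sa : sigma a b ** a = (2%:R^-1 * (f b - 1)) *: a.
  by rewrite namulC (mul_sigma b af).
have sb : sigma a b ** b = (2%:R^-1 * (g a - 1)) *: b.
  by rewrite namulC sigmaC (mul_sigma a bg).
have := sigma_comm b b af; rewrite sb namulZr => e1.
have := sigma_comm a a bg; rewrite (sigmaC b) sa namulZr (namulC b) -e1.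
move=> /eqP; rewrite -subr_eq0 -scalerBl scaler_eq0 => /orP[|/eqP ab].
  rewrite -mulrBr mulf_eq0 invr_eq0 (negPf two_neq0) /=.
  by rewrite subr_eq0 => /eqP/addIr.
have z c d h : c ** d = 0 -> axis_form c h -> h d = 0.
  move=> cd ch; have := axis_peirce ch d; rewrite cd !namE scaler0 add0r.
  move=> /esym/eqP; rewrite scaler_eq0 (negPf (axis_nz ch)) orbF mulf_eq0.
  by rewrite invr_eq0 (negPf two_neq0) => /eqP.
by rewrite (z _ _ _ ab af) (z _ _ _ _ bg) // namulC.
Qed.

End Miyamoto.

(** * The invariant form of an algebra spanned by primitive axes *)

Section Frobenius.
Variables (K : fieldType) (A : commNAAlgType K).
Hypothesis two_neq0 : (2%:R : K) != 0.
Implicit Types (x y z a b c : A) (k : K).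

Definition axis_span (T : commNAAlgType K) (x : T) : Prop :=
  exists s : seq (K * T), (forall p, p \in s -> primitive_axis p.2) /\
    x = \sum_(p <- s) p.1 *: p.2.

Definition spanned_by_axes (T : commNAAlgType K) := forall x : T, axis_span x.

Lemma axis_span_axis c : primitive_axis c -> axis_span c.
Proof.
exists [:: (1, c)]; split; last by rewrite big_seq1 scale1r.
by move=> p; rewrite inE => /eqP ->.
Qed.

Lemma axis_spanD x y : axis_span x -> axis_span y -> axis_span (x + y).
Proof.
move=> [s [sP ->]] [t [tP ->]]; exists (s ++ t); rewrite big_cat; split=> // p.
by rewrite mem_cat => /orP[/sP|/tP].
Qed.

Lemma axis_spanZ k x : axis_span x -> axis_span (k *: x).
Proof.
move=> [s [sP ->]]; exists [seq (k * p.1, p.2) | p <- s]; split.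
  by move=> p /mapP[q qs ->]; exact: (sP q).
by rewrite big_map scaler_sumr; apply: eq_bigr => p _; rewrite scalerA.
Qed.

Lemma axis_span0 : axis_span (0 : A).
Proof. by exists [::]; rewrite big_nil. Qed.

Lemma spanned_ind (spanA : spanned_by_axes A) (P : A -> Prop) :
    (forall x y, P x -> P y -> P (x + y)) -> (forall k x, P x -> P (k *: x)) ->
    P 0 -> (forall c, primitive_axis c -> P c) ->
  forall x, P x.
Proof.
move=> PD PZ P0 Pc x; have [s [sP ->]] := spanA x.
elim: s sP => [|p s IHs] sP; first by rewrite big_nil.
rewrite big_cons; apply: PD.
  by apply/PZ/Pc/sP; rewrite mem_head.
by apply: IHs => q qs; apply: sP; rewrite inE qs orbT.
Qed.

Record frobenius_form (B : A -> A -> K) : Prop := FrobeniusForm {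
  frob_linear : forall x, linear_form (B x);
  frobC : forall x y, B x y = B y x;
  frob_axis : forall c, primitive_axis c -> axis_form c (B c);
  frobM : forall x y z, B (x ** y) z = B y (x ** z)
}.

(** Expand the first argument in axes, by a chosen expression, and apply their forms to the second.
    By [axis_form_sym] the result is symmetric, hence independent of the choice. Invariance need
    only be checked for multiplication by an axis [c], where it amounts to the Miyamoto involution
    being self-adjoint. *)
Lemma frobenius_form_exists :
  spanned_by_axes A -> exists B : A -> A -> K, frobenius_form B.
Proof.
move=> spanA; have [s sP] := choice spanA.
have phi_ex c : exists f, primitive_axis c -> axis_form c f.
  have [/(primitive_axis_form two_neq0)[f cf]|nc] := pselect (primitive_axis c).
    by exists f.
  by exists (fun=> 0).
have [phi phiP] := choice phi_ex.
have [B BE] : {B : A -> A -> K |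
    forall x y, B x y = \sum_(p <- s x) p.1 * phi p.2 y} by eexists.
have BL x : linear_form (B x).
  split=> [y z|k y]; rewrite !BE.
    rewrite -big_split; apply: eq_big_seq => p /(proj1 (sP x))/phiP pP.
    by rewrite (formD (axis_linear pP)) mulrDr.
  rewrite mulr_sumr; apply: eq_big_seq => p /(proj1 (sP x))/phiP pP.
  by rewrite (formZ (axis_linear pP)) mulrCA.
have BcE x c : primitive_axis c -> B x c = phi c x.
  move=> cP; have cL := axis_linear (phiP c cP).
  have -> : phi c x = \sum_(p <- s x) p.1 * phi c p.2.
    rewrite {1}(proj2 (sP x)).
    elim: (s x) => [|p t IHt]; first by rewrite !big_nil (form0 cL).
    by rewrite !big_cons !(formE cL) IHt.
  rewrite BE; apply: eq_big_seq => p /(proj1 (sP x)) pP; congr (_ * _).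
  exact: (axis_form_sym two_neq0 (phiP _ pP) (phiP _ cP)).
have BC x y : B x y = B y x.
  rewrite {1}(proj2 (sP y)) [RHS]BE.
  have : forall p, p \in s y -> primitive_axis p.2 by exact: (proj1 (sP y)).
  elim: (s y) => [|p t IHt] tP; first by rewrite !big_nil (form0 (BL x)).
  rewrite !big_cons !(formE (BL x)) (BcE _ _ (tP _ (mem_head _ _))) IHt // => q qt.
  by apply: tP; rewrite inE qt orbT.
have BcF c : primitive_axis c -> axis_form c (B c).
  move=> cP; have -> : B c = phi c by apply/funext => x; rewrite BC BcE.
  exact: phiP.
exists B; split=> // x y z.
have BLl w u v : B (u + v) w = B u w + B v w by rewrite !(BC _ w) (formD (BL w)).
have BZl w k u : B (k *: u) w = k * B u w by rewrite !(BC _ w) (formZ (BL w)).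
elim/(@spanned_ind spanA): x => [x x' ex ex'|k x ex||c cP].
- by rewrite !namE BLl ex ex' (formD (BL y)).
- by rewrite !namE BZl ex (formZ (BL y)).
- by rewrite !namE BC !(form0 (BL _)).
have cF := BcF c cP; pose tau := miyamoto c (B c).
have tauD : forall u v, tau (u + v) = tau u + tau v := miyamotoD cF.
have tauZ : forall k u, tau (k *: u) = k *: tau u := miyamotoZ cF.
have tauK : involutive tau := miyamotoK two_neq0 cF.
(* For an axis [d], [tau d] is again a primitive axis with form [B d \o tau]; uniqueness of the form
   gives the claim. *)
have tau_iso u v : B (tau u) v = B u (tau v).
  elim/(@spanned_ind spanA): u => [u u' eu eu'|k u eu||d dP].
  - by rewrite tauD BLl eu eu' BLl.
  - by rewrite tauZ BZl eu BZl.
  - by rewrite -(scale0r (0 : A)) tauZ !BZl !mul0r.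
  have dF := axis_form_aut tauD tauZ (miyamotoM two_neq0 cF) tauK (BcF d dP).
  have tdP := axis_form_primitive two_neq0 dF.
  exact: (axis_form_uniq two_neq0 (BcF _ tdP) dF).
have := tau_iso y z; rewrite /tau /miyamoto.
have BN w u : B (- u) w = - B u w by rewrite -scaleN1r BZl mulN1r.
rewrite !(BLl, BZl, BN) !(formE (BL _)) (BC y c).
move=> e; have four_neq0 : (4%:R : K) != 0.
  by rewrite (natrM _ 2 2) mulf_neq0.
apply: (mulfI four_neq0); apply: oppr_inj; rewrite -!mulNr.
have -> : - 4%:R * B (c ** y) z
  = (B y z - 4%:R * B (c ** y) z + 4%:R * B c y * B c z)
    - B y z - 4%:R * B c y * B c z by ring.
by rewrite e; ring.
Qed.

End Frobenius.

(** * Axes as zeros of quadratic maps, and the algebra generated by two axes *)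

Section Frobenius.
Variables (K : fieldType) (A : commNAAlgType K).
Hypothesis two_neq0 : (2%:R : K) != 0.
Variables (B : A -> A -> K) (frobB : frobenius_form B).
Implicit Types (x y z c d : A) (k : K) (q : A -> A -> A).

Lemma frobDl x y z : B (x + y) z = B x z + B y z.
Proof. by rewrite !(frobC frobB _ z) (formD (frob_linear frobB z)). Qed.

Lemma frobZl k x z : B (k *: x) z = k * B x z.
Proof. by rewrite !(frobC frobB _ z) (formZ (frob_linear frobB z)). Qed.

Lemma frobNl x z : B (- x) z = - B x z.
Proof. by rewrite -scaleN1r frobZl mulN1r. Qed.

Lemma frob0l z : B 0 z = 0.
Proof. by rewrite frobC // (form0 (frob_linear frobB z)). Qed.

Lemma frobDr x y z : B z (x + y) = B z x + B z y.
Proof. exact: formD (frob_linear frobB z) _ _. Qed.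

Lemma frobZr k x z : B z (k *: x) = k * B z x.
Proof. exact: formZ (frob_linear frobB z) _ _. Qed.

Lemma frobNr x z : B z (- x) = - B z x.
Proof. exact: formN (frob_linear frobB z). Qed.

Lemma frob0r z : B z 0 = 0.
Proof. exact: form0 (frob_linear frobB z). Qed.

Definition frobE :=
  (frobDl, frobZl, frobNl, frob0l, frobDr, frobZr, frobNr, frob0r).

Record sym_bilinear q : Prop := SymBilinear {
  bilC : forall c d, q c d = q d c;
  bilD : forall c d x, q (c + d) x = q c x + q d x;
  bilZ : forall k c d, q (k *: c) d = k *: q c d
}.

(* The polarisations of the identities [axis_peirce] and [axis_fusion], in
   which the terms linear in the idempotent [c] have been rewritten with
   [c ** c = c]. *)
Definition peirce x c d := c ** (d ** x) + d ** (c ** x) - (c ** d) ** x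
  - 2%:R^-1 *: (B c x *: d + B d x *: c).

Definition defect x y c d :=
  ((c ** d) ** x) ** y + x ** ((c ** d) ** y) - (c ** d) ** (x ** y)
  + 2%:R^-1 *: (B c (x ** y) *: d + B d (x ** y) *: c)
  - 2%:R *: ((c ** x) ** (d ** y) + (d ** x) ** (c ** y))
  + 2%:R^-1 *: (B c x *: (d ** y) + B d x *: (c ** y)
                + B c y *: (d ** x) + B d y *: (c ** x)).

Lemma peirce_bilinear x : sym_bilinear (peirce x).
Proof.
split=> [c d|c d e|k c d]; rewrite /peirce.
- by rewrite (namulC c d); lin_by K ltac:(ring).
- by rewrite !namE !frobE; lin_by K ltac:(ring).
- by rewrite !namE !frobE; lin_by K ltac:(ring).
Qed.

Lemma defect_bilinear x y : sym_bilinear (defect x y).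
Proof.
split=> [c d|c d e|k c d]; rewrite /defect.
- by rewrite (namulC c d); lin_by K ltac:(ring).
- by rewrite !namE !frobE; lin_by K ltac:(ring).
- by rewrite !namE !frobE; lin_by K ltac:(ring).
Qed.

Lemma peirce_axis x c : primitive_axis c -> peirce x c c = 0.
Proof.
move=> /(frob_axis frobB) cF; rewrite /peirce (axis_idemp cF) (axis_peirce cF).
by lin_by K ltac:(by field).
Qed.

Lemma defect_axis x y c : primitive_axis c -> defect x y c c = 0.
Proof.
move=> /(frob_axis frobB) cF; rewrite /defect (axis_idemp cF) (axis_fusion cF).
by lin_by K ltac:(by field).
Qed.

Lemma idempotent_axis c : c != 0 -> c ** c = c ->
    (forall x, peirce x c c = 0) -> (forall x y, defect x y c c = 0) ->
  axis_form c (B c).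
Proof.
move=> c0 cc cp cd.
have E x : c ** (c ** x) = 2%:R^-1 *: (c ** x) + (2%:R^-1 * B c x) *: c.
  have := cp x; rewrite /peirce cc => e.
  have -> : c ** (c ** x) = 2%:R^-1 *: 0 + 2%:R^-1 *: (c ** x)
     + (2%:R^-1 * B c x) *: c by rewrite -e; lin_by K ltac:(by field).
  by rewrite scaler0 add0r.
split=> //; first exact: frob_linear.
- move=> x y; have := cd x y; rewrite /defect cc => e.
  rewrite -[LHS]addr0 -e; lin_by K ltac:(by field).
(* [axis_assoc] is a consequence of the Peirce identity once the form is invariant. *)
- have H u v : B c ((c ** u) ** v)
      = 2%:R^-1 * B v (c ** u) + 2%:R^-1 * B c u * B v c.
    by rewrite frobC // frobM // (namulC _ c) E !frobE.
  move=> x y; rewrite (namulC x (c ** y)) !H (frobC frobB c (x ** y)).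
  rewrite (frobC frobB x (c ** y)) !frobM // (namulC x c) !(frobC frobB _ c).
  by field.
Qed.

Section Pair.
Variables (a b : A) (aP : primitive_axis a) (bP : primitive_axis b).
Let aF := frob_axis frobB aP.
Let bF := frob_axis frobB bP.
Local Notation al := (B a b).
Local Notation p := (2%:R^-1 * (B a b - 1)).
Local Notation s := (sigma a b).

Lemma frob_axis1 c : primitive_axis c -> B c c = 1.
Proof. by move=> /(frob_axis frobB)/(axis_form1 two_neq0). Qed.

Lemma pair_ab : a ** b = s + 2%:R^-1 *: a + 2%:R^-1 *: b.
Proof. by rewrite sigmaE; lin_by K ltac:(ring). Qed.

Lemma pair_as : a ** s = p *: a.
Proof. exact: mul_sigma aF. Qed.

Lemma pair_bs : b ** s = p *: b.
Proof. by rewrite sigmaC (mul_sigma _ bF) (frobC frobB b). Qed.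

(** Only one factor is expanded: [s(ab) = a(sb) = p ab] by [sigma_comm]. *)
Lemma pair_ss : s ** s = p *: s.
Proof.
have -> : s ** s = s ** (a ** b - 2%:R^-1 *: a - 2%:R^-1 *: b).
  by rewrite -sigmaE.
rewrite !namE -(sigma_comm two_neq0 b b aF) (namulC s b) pair_bs.
rewrite (namulC s a) pair_as !namE pair_ab; lin_by K ltac:(ring).
Qed.

Lemma frob_as : B a s = p.
Proof.
rewrite sigmaE !frobE (axis_formM two_neq0 b aF) (frob_axis1 aP).
by field.
Qed.

Lemma frob_bs : B b s = p.
Proof.
rewrite sigmaE !frobE (namulC a b) (axis_formM two_neq0 a bF) (frob_axis1 bP).
by rewrite (frobC frobB b); field.
Qed.

Lemma frob_ss : B s s = 2%:R * p * p.
Proof.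
rewrite {1}sigmaE !frobE frobM // pair_as frob_as frob_bs !frobE (frobC frobB b).
by field.
Qed.

Lemma frob_sx x : B s x = B a (b ** x) - 2%:R^-1 * B a x - 2%:R^-1 * B b x.
Proof. by rewrite sigmaE !frobE (namulC a) frobM // (frobC frobB b). Qed.

Definition reflected := (4%:R * al - 2%:R) *: b - a - 4%:R *: s.

Lemma miyamoto_axis : miyamoto b (B b) a = reflected.
Proof.
rewrite /miyamoto /reflected (namulC b) pair_ab (frobC frobB b).
by lin_by K ltac:(by field).
Qed.

Lemma reflected_axis : primitive_axis reflected.
Proof.
rewrite -miyamoto_axis; apply: (axis_form_primitive two_neq0).
apply: (axis_form_aut (miyamotoD bF) (miyamotoZ bF) (miyamotoM two_neq0 bF)
  (miyamotoK two_neq0 bF) aF).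
Qed.

Lemma frob_reflected : B b reflected = al.
Proof.
rewrite /reflected !frobE frob_bs (frob_axis1 bP) (frobC frobB b); by field.
Qed.

(** The involution of [b] fixes [s]. Thus the pairs [(a, b)] and [(b, reflected)] share [s] as well
    as the value of [B], and identities for the first pair carry over to the second. *)
Lemma sigma_reflected : sigma b reflected = s.
Proof.
rewrite sigmaE /reflected !namE pair_bs (axis_idemp bF) (namulC b) pair_ab.
by lin_by K ltac:(by field).
Qed.

(** [sigma_comm] reduces [peirce x a s] to an expression in [(ab)(ax)], which [axis_fusion] of [a]
    on the product [bx] eliminates. *)
Lemma peirce_as x : peirce x a b = - 2%:R *: peirce x a s.
Proof.
have -> : peirce x a s = 2%:R *: ((a ** b) ** (a ** x))
   - (a ** (a ** x)) - b ** (a ** x) - p *: (a ** x)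
   - 2%:R^-1 *: (B a x *: s + B s x *: a).
  rewrite /peirce (sigma_comm two_neq0 b x aF) pair_as.
  have -> : s ** (a ** x) = (a ** b) ** (a ** x) - 2%:R^-1 *: (a ** (a ** x))
     - 2%:R^-1 *: (b ** (a ** x)) by rewrite sigmaE !namE.
  by rewrite namulZl; lin_by K ltac:(by field).
have -> : (a ** b) ** (a ** x) = (2%:R^-1 * 2%:R^-1) *: (B a (b ** x) *: a
    + (a ** b) ** x + b ** (a ** x) - a ** (b ** x)
    + B a b *: (a ** x) + B a x *: (a ** b)).
  by rewrite (axis_fusion aF); lin_by K ltac:(by field).
rewrite /peirce (axis_peirce aF) frob_sx pair_ab !namE.
by lin_by K ltac:(by field).
Qed.

End Pair.
End Frobenius.

(** * Quadratic maps on the conic *)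

Section Conic.
Variables (K : fieldType) (A : commNAAlgType K).
Hypothesis two_neq0 : (2%:R : K) != 0.
Variables (B : A -> A -> K) (frobB : frobenius_form B).
Implicit Types (x y z : K) (c d : A) (q : A -> A -> A).

Section Bilinear.
Variables (q : A -> A -> A) (qB : sym_bilinear q).

Lemma bilDr c d e : q e (c + d) = q e c + q e d.
Proof. by rewrite !(bilC qB e) (bilD qB). Qed.

Lemma bilZr k c d : q d (k *: c) = k *: q d c.
Proof. by rewrite !(bilC qB d) (bilZ qB). Qed.

Lemma bilNl c d : q (- c) d = - q c d.
Proof. by rewrite -scaleN1r (bilZ qB) scaleN1r. Qed.

Lemma bilNr c d : q d (- c) = - q d c.
Proof. by rewrite !(bilC qB d) bilNl. Qed.

Definition bilE := (bilD qB, bilZ qB, bilNl, bilDr, bilZr, bilNr).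
End Bilinear.

Lemma scale_eq0 k (x : A) : k != 0 -> k *: x = 0 -> x = 0.
Proof. by move=> k0 /eqP; rewrite scaler_eq0 (negPf k0) => /eqP. Qed.

(* Idempotents [x a + y b + z s] with [x + y + 2 p z = 1] satisfy this equation;
   [p] stands for [(B a b - 1) / 2]. *)
Definition conic (p x y z : K) : Prop :=
  2%:R * x * y = (x + y) * z + p * z * z.

Definition combination (a b : A) (x y z : K) := x *: a + y *: b + z *: sigma a b.

Section Pair.
Variables (a b : A) (aP : primitive_axis a) (bP : primitive_axis b).
Local Notation al := (B a b).
Local Notation p := (2%:R^-1 * (B a b - 1)).
Local Notation s := (sigma a b).

(** The value of [q] is [2 ((x + y) z + p z^2 - 2 x y) r], a multiple of the equation of the
    conic. *)
Lemma bilinear_conic q r x y z : sym_bilinear q ->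
    q a a = 0 -> q b b = 0 -> q a b = - 2%:R *: r -> q a s = r -> q b s = r ->
    q s s = (2%:R * p) *: r -> conic p x y z ->
  q (combination a b x y z) (combination a b x y z) = 0.
Proof.
move=> qB aa bb ab as_ bs ss cxyz.
rewrite /combination !(bilE qB) aa bb (bilC qB b a) (bilC qB s a) (bilC qB s b).
rewrite ab as_ bs ss.
rewrite -[RHS](scale0r r) -(subrr ((2%:R : K) * (2%:R * x * y))) {1}cxyz.
by lin_by K ltac:(by field).
Qed.

(** The vanishing of [q] at the reflection of [a] in [b], solved for [q s s], which occurs there
    with coefficient 16. *)
Lemma bilinear_reflected q : sym_bilinear q ->
    (forall c, primitive_axis c -> q c c = 0) ->
  q s s = (2%:R^-1 * (al - 2%:R^-1)) *: q a b - 2%:R^-1 *: q a s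
       + (2%:R * al - 1) *: q b s.
Proof.
move=> qB qP; have := qP _ (reflected_axis two_neq0 frobB aP bP).
rewrite /reflected !(bilE qB) (qP _ aP) (qP _ bP).
rewrite (bilC qB b a) (bilC qB s a) (bilC qB s b) => e.
rewrite -[LHS]subr0 -(scaler0 _ (2%:R^-1 * 2%:R^-1 * (2%:R^-1 * 2%:R^-1))) -e.
by lin_by K ltac:(by field).
Qed.

(** The reflections of [a] in [b] and of [b] in [a] give two values of [q s s]; they differ by
    [(4 al - 1)/2] times [q a s - q b s]. *)
Lemma bilinear_as_bs q : sym_bilinear q ->
    (forall c, primitive_axis c -> q c c = 0) -> 4%:R * al != 1 ->
  q a s = q b s.
Proof.
move=> qB qP al4; have e1 := bilinear_reflected qB qP.
have := qP _ (reflected_axis two_neq0 frobB bP aP).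
rewrite /reflected sigmaC (frobC frobB b) !(bilE qB) (qP _ aP) (qP _ bP).
rewrite (bilC qB b a) (bilC qB s a) (bilC qB s b) e1 => e.
apply/eqP; rewrite -subr_eq0; apply/eqP.
apply: (@scale_eq0 (8%:R * (4%:R * al - 1))).
  rewrite mulf_neq0 ?subr_eq0 // (natrM _ 2 4) (natrM _ 2 2).
  by rewrite !mulf_neq0.
rewrite -[RHS]oppr0 -e; lin_by K ltac:(by field).
Qed.

End Pair.

Section Pair.
Variables (a b : A) (aP : primitive_axis a) (bP : primitive_axis b).
Local Notation al := (B a b).
Local Notation p := (2%:R^-1 * (B a b - 1)).
Local Notation s := (sigma a b).

(** [bilinear_as_bs] for the pair [(b, reflected)] reads [q b s = (4 al - 2) q b s - q a s - 4 q s
    s]. *)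
Lemma bilinear_ss q : sym_bilinear q ->
    (forall c, primitive_axis c -> q c c = 0) -> 4%:R * al != 1 ->
  q s s = (2%:R * p) *: q a s.
Proof.
move=> qB qP al4; have cP := reflected_axis two_neq0 frobB aP bP.
have := bilinear_as_bs bP cP qB qP.
rewrite (frob_reflected two_neq0 frobB a bP) => /(_ al4).
rewrite (sigma_reflected two_neq0 frobB a bP) /reflected !(bilE qB).
rewrite -(bilinear_as_bs aP bP qB qP al4) => /eqP; rewrite -subr_eq0 => /eqP e.
rewrite -[LHS]subr0 -(scaler0 _ (2%:R^-1 * 2%:R^-1)) -e.
by lin_by K ltac:(by field).
Qed.

Lemma peirce_bs t : peirce B t b s = peirce B t a s.
Proof.
have qB := peirce_bilinear frobB t.
have := peirce_as two_neq0 frobB a bP t.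
rewrite sigmaC (bilC qB b a) (peirce_as two_neq0 frobB b aP t) => /eqP.
rewrite -subr_eq0 -scalerBr => /eqP.
have two_neq0' : (- 2%:R : K) != 0 by rewrite oppr_eq0.
by move=> /(scale_eq0 two_neq0')/eqP; rewrite subr_eq0 => /eqP ->.
Qed.

Lemma peirce_ss t : peirce B t s s = (2%:R * p) *: peirce B t a s.
Proof.
have qB := peirce_bilinear frobB t.
have qP c := @peirce_axis _ _ two_neq0 _ frobB t c.
rewrite (bilinear_reflected aP bP qB qP) peirce_bs.
rewrite (peirce_as two_neq0 frobB b aP t).
by lin_by K ltac:(by field).
Qed.

Lemma peirce_conic t x y z : conic p x y z ->
  peirce B t (combination a b x y z) (combination a b x y z) = 0.
Proof.
have qP c := @peirce_axis _ _ two_neq0 _ frobB t c.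
apply: (bilinear_conic (peirce_bilinear frobB t) (qP _ aP) (qP _ bP)
  (peirce_as two_neq0 frobB b aP t)) => //; [exact: peirce_bs | exact: peirce_ss].
Qed.

(** Put [r = q a s = q b s] and [q s s = 2 p r] into [bilinear_reflected]: what is left is a quarter
    of [(2 al - 1) (q a b + 2 r) = 0]. *)
Lemma defect_conic t u x y z : 4%:R * al != 1 -> 2%:R * al != 1 ->
    conic p x y z ->
  defect B t u (combination a b x y z) (combination a b x y z) = 0.
Proof.
move=> al4 al2; have qB := defect_bilinear frobB t u.
have qP c := @defect_axis _ _ two_neq0 _ frobB t u c.
have e1 := bilinear_as_bs aP bP qB qP al4.
have e2 := bilinear_ss qB qP al4.
apply: (bilinear_conic qB (qP _ aP) (qP _ bP)) => //.
have := bilinear_reflected aP bP qB qP; rewrite e2 -e1 => /eqP.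
rewrite -subr_eq0 => /eqP e.
apply/eqP; rewrite -subr_eq0; apply/eqP.
apply: (@scale_eq0 (2%:R * al - 1)); first by rewrite subr_eq0.
rewrite -[RHS](scaler0 _ (- 2%:R ^+ 2)) -e; lin_by K ltac:(by field).
Qed.

End Pair.
End Conic.

(** * The case 1/4 with a fourth axis *)

Section Quarter.
Variables (K : fieldType) (A : commNAAlgType K).
Hypothesis two_neq0 : (2%:R : K) != 0.
Variables (B : A -> A -> K) (frobB : frobenius_form B).
Implicit Types (x y z : K) (c d : A) (q : A -> A -> A).

Lemma miyamoto_primitive a c : primitive_axis a -> primitive_axis c ->
  primitive_axis (miyamoto a (B a) c).
Proof.
move=> /(frob_axis frobB) aF /(frob_axis frobB) cF.
apply: (axis_form_primitive two_neq0).
exact: (axis_form_aut (miyamotoD aF) (miyamotoZ aF) (miyamotoM two_neq0 aF)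
  (miyamotoK two_neq0 aF) cF).
Qed.

Definition on_conic (p x y z : K) : Prop :=
  conic p x y z /\ x + y + 2%:R * p * z = 1.

Lemma miyamoto_self a : primitive_axis a -> miyamoto a (B a) a = a.
Proof.
move=> aP; rewrite /miyamoto (axis_idemp (frob_axis frobB aP)).
by rewrite (frob_axis1 two_neq0 frobB aP); lin_by K ltac:(ring).
Qed.

Lemma miyamoto_sigma a b : primitive_axis a ->
  miyamoto a (B a) (sigma a b) = sigma a b.
Proof.
move=> aP; rewrite /miyamoto (pair_as frobB b aP) (frob_as two_neq0 frobB b aP).
by lin_by K ltac:(ring).
Qed.

Lemma miyamoto_combination a b x y z : primitive_axis a -> 4%:R * B a b = 1 ->
  miyamoto a (B a) (combination a b x y z)
    = combination a b (x - y) (- y) (z - 4%:R * y).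
Proof.
move=> aP al4; have aF := frob_axis frobB aP.
rewrite /combination !(miyamotoD aF) !(miyamotoZ aF) miyamoto_self //.
rewrite miyamoto_sigma // (miyamoto_axis two_neq0 frobB b a) /reflected.
rewrite (frobC frobB b) al4 (sigmaC b); lin_by K ltac:(by ring).
Qed.

Section Pair.
Variables (a b : A) (aP : primitive_axis a) (bP : primitive_axis b).
Hypothesis al4 : 4%:R * B a b = 1.
Local Notation p := (2%:R^-1 * (B a b - 1)).
Local Notation s := (sigma a b).

Lemma quarterE : B a b = 2%:R^-1 * 2%:R^-1.
Proof.
have -> : B a b = 2%:R^-1 * 2%:R^-1 * (4%:R * B a b) by field.
by rewrite al4 mulr1.
Qed.

Lemma on_conic_miyamoto x y z : on_conic p x y z ->
  on_conic p (x - y) (- y) (z - 4%:R * y).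
Proof.
rewrite /on_conic /conic quarterE => -[cc t]; split; last by rewrite -[RHS]t; field.
apply/eqP; rewrite -subr_eq0; apply/eqP.
set w := (X in _ = X) in cc; rewrite -[RHS](subrr w) -{1}cc /w; by field.
Qed.

Lemma on_conicC x y z : on_conic p x y z -> on_conic p y x z.
Proof.
rewrite /on_conic /conic => -[e t]; split; last by rewrite -[RHS]t; ring.
by rewrite mulrAC e; ring.
Qed.

(** Needed to apply [quarter_relation] to the image under the involution of [a]. If [z = 4 y], the
    linear condition gives [x = 1 + 2 y] and the conic becomes [2 y (y + 1) = 0], where [y = 0]
    contradicts [z != 0]. *)
Lemma on_conic_neq0 x y z : on_conic p x y z -> z != 0 ->
  ~ (x = -1 /\ y = -1) -> z - 4%:R * y != 0.
Proof.
rewrite /on_conic /conic quarterE => -[cc t] z0 nxy; apply/eqP => /eqP.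
rewrite subr_eq0 => /eqP ze; rewrite {}ze in cc t z0.
have y0 : y != 0 by apply: contra_neq z0 => ->; rewrite mulr0.
have xe : x = 1 + 2%:R * y by rewrite -[X in X + _]t; field.
apply: nxy; suff yE : y = -1 by split=> //; rewrite xe yE; ring.
apply/eqP; rewrite -subr_eq0 opprK; apply/eqP.
have n0 : 2%:R * y != 0 by rewrite mulf_neq0.
apply: (mulfI n0); rewrite mulr0.
set w := (X in _ = X) in cc; rewrite -(subrr w) -{2}cc /w xe; by field.
Qed.

Variables (q : A -> A -> A) (qB : sym_bilinear q).
Hypothesis qP : forall c, primitive_axis c -> q c c = 0.

Lemma quarter_ab : q a b = - 8%:R *: q s s - 4%:R *: q a s - 4%:R *: q b s.
Proof.
rewrite (bilinear_reflected two_neq0 frobB aP bP qB qP) quarterE.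
by lin_by K ltac:(by field).
Qed.

(** Expand [q c c] and replace [2 x y] by the equation of the conic: every term acquires the factor
    [z], and division by [- 2 z] remains. *)
Lemma quarter_relation x y z : primitive_axis (combination a b x y z) ->
    on_conic p x y z -> z != 0 ->
  (1 + y) *: q a s + (1 + x) *: q b s + (4%:R + z) *: q s s = 0.
Proof.
move=> /qP; rewrite /combination !(bilE qB) (qP aP) (qP bP) (bilC qB b a).
rewrite (bilC qB s a) (bilC qB s b) quarter_ab /on_conic /conic quarterE.
move=> e [cc t] z0.
have n0 : - 2%:R * z != 0 by rewrite mulf_neq0 ?oppr_eq0.
apply: (scale_eq0 n0); rewrite -[RHS]e.
have xe : x = 1 - y - (2%:R * (2%:R^-1 * (2%:R^-1 * 2%:R^-1 - 1)) * z).
  by rewrite -[X in X - y - _]t; ring.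
set w := (X in _ = X) in cc.
rewrite -[LHS]addr0 -(scale0r (- 8%:R *: q s s - 4%:R *: q a s - 4%:R *: q b s)).
rewrite -(subrr w) -{1}cc /w {w cc e t} xe.
by lin_by K ltac:(by field).
Qed.

(** The difference of the relations for the axis and for its image under the involution of [a]. *)
Lemma quarter_relation_diff x y z : primitive_axis (combination a b x y z) ->
    on_conic p x y z -> z != 0 -> ~ (x = -1 /\ y = -1) ->
  y *: (2%:R *: q a s + q b s + 4%:R *: q s s) = 0.
Proof.
move=> cP cc z0 nxy; have := miyamoto_primitive aP cP.
rewrite miyamoto_combination // => /quarter_relation.
move=> /(_ (on_conic_miyamoto cc) (on_conic_neq0 cc z0 nxy)) e'.
have e := quarter_relation cP cc z0.
by rewrite -[RHS](subrr 0) -{1}e -e'; lin_by K ltac:(by ring).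
Qed.

End Pair.

Lemma combinationC (a b : A) x y z : combination a b x y z = combination b a y x z.
Proof. by rewrite /combination sigmaC; lin_by K ltac:(by ring). Qed.

Section Pair.
Variables (a b : A) (aP : primitive_axis a) (bP : primitive_axis b).
Hypothesis al4 : 4%:R * B a b = 1.
Local Notation p := (2%:R^-1 * (B a b - 1)).
Local Notation s := (sigma a b).
Variables (q : A -> A -> A) (qB : sym_bilinear q).
Hypothesis qP : forall c, primitive_axis c -> q c c = 0.

Lemma quarter_relations x y z : primitive_axis (combination a b x y z) ->
    on_conic p x y z -> z != 0 -> ~ (x = -1 /\ y = -1) ->
  q a s = q b s /\ q s s = (2%:R * p) *: q a s.
Proof.
move=> cP cc z0 nxy; have r1 := quarter_relation aP bP al4 qB qP cP cc z0.
have r2 := quarter_relation_diff aP bP al4 qB qP cP cc z0 nxy.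
have r3 : x *: (2%:R *: q b s + q a s + 4%:R *: q s s) = 0.
  move: cP cc nxy; rewrite combinationC (frobC frobB) sigmaC => cP.
  move=> /on_conicC cc nxy.
  apply: (quarter_relation_diff bP aP _ qB qP cP cc z0); first by rewrite frobC.
  by move=> [yE xE]; apply: nxy.
case: cc; rewrite /conic (quarterE al4) => c t.
have bs_sub u v : u - v = 0 -> u = v :> A.
  by move=> /eqP; rewrite subr_eq0 => /eqP.
have [x0|x0] := eqVneq x 0; have [y0|y0] := eqVneq y 0.
- move: c t; rewrite x0 y0 !(mulr0, mul0r, add0r) => /esym/eqP.
  rewrite mulf_eq0 (negPf z0) orbF mulf_eq0 (negPf z0) orbF => /eqP->.
  by rewrite mulr0 mul0r => /esym/eqP; rewrite oner_eq0.
(* For [x = 0] the conic gives [p z = - y] and the linear condition then [y = -1]. So [q a s] drops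
   out of [r1], which yields [q s s]; [r2] yields the rest. *)
- move: r2 => /(scale_eq0 y0) r2; move: r1 c t.
  rewrite x0 mulr0 mul0r !add0r => r1 c t.
  have zp : 2%:R^-1 * (2%:R^-1 / 2%:R - 1) * z = - y.
    by apply: (mulIf z0); rewrite mulNr -[LHS](addKr (y * z)) -c; ring.
  have yE : y = -1.
    rewrite -[X in - X]t -(mulrA 2%:R) zp; ring.
  have e1 : q s s = (2%:R * (2%:R^-1 * (2%:R^-1 / 2%:R - 1))) *: q b s.
    apply: bs_sub; rewrite -[RHS](scaler0 _ (- 2%:R * (2%:R^-1 * (2%:R^-1 / 2%:R - 1)))).
    have zp1 : 2%:R^-1 * (2%:R^-1 / 2%:R - 1) * z - 1 = 0
      by rewrite zp yE opprK subrr.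
    rewrite -{}r1 yE -[LHS]subr0 -(scale0r (2%:R *: q s s)).
    rewrite -[X in X *: (2%:R *: q s s)]zp1.
    by lin_by K ltac:(by field).
  have e : q a s = q b s.
    apply: bs_sub; rewrite -[RHS](scaler0 _ (2%:R^-1)) -r2 e1.
    by lin_by K ltac:(by field).
  by rewrite e1 e.
- move: r3 => /(scale_eq0 x0) r3; move: r1 c t.
  rewrite y0 mulr0 !addr0 => r1 c t.
  have zp : 2%:R^-1 * (2%:R^-1 / 2%:R - 1) * z = - x.
    by apply: (mulIf z0); rewrite mulNr -[LHS](addKr (x * z)) -c; ring.
  have xE : x = -1.
    rewrite -[X in - X]t -(mulrA 2%:R) zp; ring.
  have e1 : q s s = (2%:R * (2%:R^-1 * (2%:R^-1 / 2%:R - 1))) *: q a s.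
    apply: bs_sub; rewrite -[RHS](scaler0 _ (- 2%:R * (2%:R^-1 * (2%:R^-1 / 2%:R - 1)))).
    have zp1 : 2%:R^-1 * (2%:R^-1 / 2%:R - 1) * z - 1 = 0
      by rewrite zp xE opprK subrr.
    rewrite -{}r1 xE -[LHS]subr0 -(scale0r (2%:R *: q s s)).
    rewrite -[X in X *: (2%:R *: q s s)]zp1.
    by lin_by K ltac:(by field).
  split=> //; apply/esym/bs_sub; rewrite -[RHS](scaler0 _ (2%:R^-1)) -r3 e1.
  by lin_by K ltac:(by field).
move: r2 r3 => /(scale_eq0 y0) r2 /(scale_eq0 x0) r3.
have e : q a s = q b s.
  by apply: bs_sub; rewrite -[RHS](subrr 0) -{1}r2 -r3; lin_by K ltac:(by ring).
split=> //; apply: bs_sub; rewrite -[RHS](scaler0 _ (2%:R^-1 * 2%:R^-1)) -r2 -e.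
by lin_by K ltac:(by field).
Qed.

End Pair.

Section Pair.
Variables (a b : A) (aP : primitive_axis a) (bP : primitive_axis b).
Hypothesis al4 : 4%:R * B a b = 1.
Local Notation p := (2%:R^-1 * (B a b - 1)).
Local Notation s := (sigma a b).

Lemma defect_conic_quarter t u x0 y0 z0 x y z :
    primitive_axis (combination a b x0 y0 z0) -> on_conic p x0 y0 z0 ->
    z0 != 0 -> ~ (x0 = -1 /\ y0 = -1) -> conic p x y z ->
  defect B t u (combination a b x y z) (combination a b x y z) = 0.
Proof.
move=> cP c0 z00 nxy; have qB := defect_bilinear frobB t u.
have qP c := @defect_axis _ _ two_neq0 _ frobB t u c.
have [e1 e2] := quarter_relations aP bP al4 qB qP cP c0 z00 nxy.
apply: (bilinear_conic two_neq0 qB (qP _ aP) (qP _ bP)) => //.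
rewrite (quarter_ab aP bP al4 qB qP) e2 -e1 (quarterE al4).
by lin_by K ltac:(by field).
Qed.

End Pair.
End Quarter.

(** * The case 1/2 *)

Section Half.
Variables (K : fieldType) (A : commNAAlgType K).
Hypothesis two_neq0 : (2%:R : K) != 0.
Variables (B : A -> A -> K) (frobB : frobenius_form B).
Implicit Types (x y z : A) (k : K).

Lemma defect_sym x y c d : defect B x y c d = defect B y x c d.
Proof.
rewrite /defect (namulC x y) ![x ** _]namulC ![y ** _]namulC.
rewrite (namulC (c ** x) (d ** y)) (namulC (d ** x) (c ** y)).
by lin_by K ltac:(by ring).
Qed.

Lemma defectD x x' y c d :
  defect B (x + x') y c d = defect B x y c d + defect B x' y c d.
Proof. by rewrite /defect !namE !(frobE frobB); lin_by K ltac:(by ring). Qed.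

Lemma defectZ k x y c d : defect B (k *: x) y c d = k *: defect B x y c d.
Proof. by rewrite /defect !namE !(frobE frobB); lin_by K ltac:(by ring). Qed.

(** * Vanishing of the defect on orthogonal vectors [v], [w] with common square [u] *)

Section Orthogonal.
Variables u v w : A.
Hypotheses (uv : u ** v = v) (uw : u ** w = w) (vv : v ** v = u)
  (ww : w ** w = u) (vw : v ** w = 0).
Hypotheses (Buu : B u u = 2%:R) (Bvv : B v v = 2%:R) (Bww : B w w = 2%:R)
  (Buv : B u v = 0) (Buw : B u w = 0) (Bvw : B v w = 0).
Hypotheses (cuv : forall x, u ** (v ** x) = v ** (u ** x))
  (cuw : forall x, u ** (w ** x) = w ** (u ** x)).
Hypotheses (puv : forall x, peirce B x u v = 0)
  (puw : forall x, peirce B x u w = 0) (pvw : forall x, peirce B x v w = 0)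
  (puuvv : forall x, peirce B x u u + peirce B x v v = 0)
  (puuww : forall x, peirce B x u u + peirce B x w w = 0).
Hypotheses (uvP : primitive_axis (2%:R^-1 *: (u + v)))
  (uwP : primitive_axis (2%:R^-1 *: (u + w))).

Let BC x y := frobC frobB x y.
Let BM x y z := frobM frobB x y z.

(** As [u] and [v] act by commuting maps and [uv = v], [peirce x u v = 0] can be solved for [u(vx)].
    For [x] orthogonal to [u] and [v] it makes [vx] a 1/2-eigenvector of [u]. *)
Lemma mul_uv x : u ** (v ** x) = 2%:R^-1 *: (v ** x)
  + (2%:R^-1 * 2%:R^-1) *: (B u x *: v + B v x *: u).
Proof.
rewrite -[LHS]subr0 -(scaler0 _ (2%:R^-1)) -(puv x) /peirce uv -cuv.
by lin_by K ltac:(by field).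
Qed.

Lemma mul_uw x : u ** (w ** x) = 2%:R^-1 *: (w ** x)
  + (2%:R^-1 * 2%:R^-1) *: (B u x *: w + B w x *: u).
Proof.
rewrite -[LHS]subr0 -(scaler0 _ (2%:R^-1)) -(puw x) /peirce uw -cuw.
by lin_by K ltac:(by field).
Qed.

(** Here the defect collapses to [- 2] times [peirce y v w]. *)
Lemma defect_u y : defect B u y v w = 0.
Proof.
have e := pvw y; rewrite -(scaler0 _ (- 2%:R)) -e /defect /peirce vw.
rewrite !(BC v (u ** y)) !(BC w (u ** y)) !BM uv uw (namulC v u) (namulC w u) uv uw.
rewrite !namE (BC v u) (BC w u) Buv Buw !(BC y).
by lin_by K ltac:(by field).
Qed.

Lemma defect_v y : defect B v y v w = 0.
Proof.
rewrite /defect vw vv (namulC w v) vw Bvv (BC w v) Bvw.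
rewrite (BC v (v ** y)) (BC w (v ** y)) !BM vv vw !(frobE frobB) (BC y u).
by rewrite mul_uw !namE; lin_by K ltac:(by field).
Qed.

Lemma defect_w y : defect B w y v w = 0.
Proof.
rewrite /defect vw ww Bww Bvw.
rewrite (BC v (w ** y)) (BC w (w ** y)) !BM ww (namulC w v) vw !(frobE frobB).
rewrite (BC y u) mul_uv !namE; lin_by K ltac:(by field).
Qed.

Definition perp x := [/\ B u x = 0, B v x = 0 & B w x = 0].

Lemma perp_v x : perp x -> perp (v ** x).
Proof.
move=> [ux vx wx]; split; rewrite BC BM ?vv ?vw ?(namulC v u) ?uv BC //.
by rewrite (frobE frobB).
Qed.

Lemma perp_w x : perp x -> perp (w ** x).
Proof.
move=> [ux vx wx]; split; rewrite BC BM ?ww ?(namulC w v) ?vw ?(namulC w u) ?uw BC //.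
by rewrite (frobE frobB).
Qed.

Lemma perp_uv x : perp x -> u ** (v ** x) = 2%:R^-1 *: (v ** x).
Proof. by case=> ux vx wx; rewrite mul_uv ux vx; lin_by K ltac:(by ring). Qed.

Lemma perp_uw x : perp x -> u ** (w ** x) = 2%:R^-1 *: (w ** x).
Proof. by case=> ux vx wx; rewrite mul_uw ux wx; lin_by K ltac:(by ring). Qed.

Lemma perp_wv x : perp x -> w ** (v ** x) = - (v ** (w ** x)).
Proof.
case=> ux vx wx; rewrite -[LHS]subr0 -(pvw x) /peirce vw vx wx !namE.
by lin_by K ltac:(by ring).
Qed.

Lemma uu : u ** u = u.
Proof.
have := puv v; rewrite /peirce !(uv, vv) Buv Bvv => e.
rewrite -[LHS]subr0 -e; lin_by K ltac:(by field).
Qed.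

Lemma perp_vv x : perp x -> v ** (v ** x) = u ** x - u ** (u ** x).
Proof.
case=> ux vx wx; rewrite -[LHS]subr0 -(scaler0 _ (2%:R^-1)) -(puuvv x).
by rewrite /peirce vv uu ux vx; lin_by K ltac:(by field).
Qed.

Lemma perp_ww x : perp x -> w ** (w ** x) = u ** x - u ** (u ** x).
Proof.
case=> ux vx wx; rewrite -[LHS]subr0 -(scaler0 _ (2%:R^-1)) -(puuww x).
by rewrite /peirce ww uu ux wx; lin_by K ltac:(by field).
Qed.

(** On the image of [v], [u] acts as 1/2, so the square of the action of [v] is [1/2 - 1/4]. *)
Lemma perp_vvv x : perp x ->
  v ** (v ** (v ** x)) = (2%:R^-1 * 2%:R^-1) *: (v ** x).
Proof.
move=> xp; rewrite (perp_vv (perp_v xp)) !perp_uv // !namE perp_uv //.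
by lin_by K ltac:(by field).
Qed.

Lemma perp_vvw x : perp x ->
  v ** (v ** (w ** x)) = (2%:R^-1 * 2%:R^-1) *: (w ** x).
Proof.
move=> xp; rewrite (perp_vv (perp_w xp)) !perp_uw // !namE perp_uw //.
by lin_by K ltac:(by field).
Qed.

Let tau x := x - 2%:R *: (u ** x) - 2%:R *: (v ** x) + (B u x + B v x) *: (u + v).
Let rho x := x - 2%:R *: (u ** x) - 2%:R *: (w ** x) + (B u x + B w x) *: (u + w).

Lemma tauE x : tau x = miyamoto (2%:R^-1 *: (u + v)) (B (2%:R^-1 *: (u + v))) x.
Proof.
by rewrite /tau /miyamoto !namE !(frobE frobB); lin_by K ltac:(by field).
Qed.

Lemma rhoE x : rho x = miyamoto (2%:R^-1 *: (u + w)) (B (2%:R^-1 *: (u + w))) x.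
Proof.
by rewrite /rho /miyamoto !namE !(frobE frobB); lin_by K ltac:(by field).
Qed.

Lemma tauM x y : tau (x ** y) = tau x ** tau y.
Proof. by rewrite !tauE (miyamotoM two_neq0 (frob_axis frobB uvP)). Qed.

Lemma rhoM x y : rho (x ** y) = rho x ** rho y.
Proof. by rewrite !rhoE (miyamotoM two_neq0 (frob_axis frobB uwP)). Qed.

Lemma perp_tau x : perp x -> u ** x = 2%:R^-1 *: x -> tau x = - 2%:R *: (v ** x).
Proof. by move=> [ux vx _] xh; rewrite /tau xh ux vx; lin_by K ltac:(by field). Qed.

Lemma perp_rho x : perp x -> u ** x = 2%:R^-1 *: x -> rho x = - 2%:R *: (w ** x).
Proof. by move=> [ux _ wx] xh; rewrite /rho xh ux wx; lin_by K ltac:(by field). Qed.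

(** The hypothesis says [z - 2 uz = vz + wz], a 1/2-eigenvector of [u]; hence [v(vz) = w(wz) = z/4].
    So [z] lies in the image of [v] and [uz = z/2], whence [vz + wz = 0]. Multiplying by [v] and by
    [w] and adding, the mixed terms cancel by [perp_wv] and leave [z/2 = 0]. *)
Lemma perp_tau_rho z : perp z -> tau z + rho z = 0 -> z = 0.
Proof.
move=> zp; case: (zp) => uz vz wz; rewrite /tau /rho uz vz wz => e.
have e1 : z - 2%:R *: (u ** z) = v ** z + w ** z.
  by rewrite -[LHS]subr0 -(scaler0 _ (2%:R^-1)) -e; lin_by K ltac:(by field).
have e2 : u ** z - u ** (u ** z) = (2%:R^-1 * 2%:R^-1) *: z.
  have := congr1 (namul u) e1; rewrite !namE perp_uv // perp_uw // -scalerDr -e1.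
  move=> e2; apply/eqP; rewrite -subr_eq0; apply/eqP.
  apply: (scale_eq0 two_neq0); move/eqP: e2; rewrite -subr_eq0 => /eqP <-.
  by lin_by K ltac:(by field).
have e3 : u ** z = 2%:R^-1 *: z.
  have := perp_uv (perp_v zp); rewrite perp_vv // e2 !namE => e3.
  by rewrite -[u ** z]scale1r -{1}(@divff _ (2%:R * 2%:R : K)) ?mulf_neq0 //
     invfM -scalerA e3; lin_by K ltac:(by field).
have e4 : v ** z + w ** z = 0.
  by rewrite -e1 e3; lin_by K ltac:(by field).
have e5 := congr1 (namul v) e4; have e6 := congr1 (namul w) e4.
move: e5 e6; rewrite !namE perp_wv // perp_vv // perp_ww // e2 => e5 e6.
apply: (scale_eq0 (k := 2%:R^-1)); first by rewrite invr_eq0.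
by rewrite -[RHS]addr0 -{1}e5 -e6; lin_by K ltac:(by field).
Qed.

(** [tau] and [rho] are multiplicative. On the factors, [tau] acts as [- 2 v], while [rho] sends
    [vx] to [2 v(wx)] and [wx] to [- 2 v(vx)]; thus [rho] gives the two summands of [tau f]
    exchanged and with opposite sign. *)
Lemma tau_rho_anti x y : perp x -> perp y ->
  let f := (v ** x) ** (w ** y) + (w ** x) ** (v ** y) in tau f + rho f = 0.
Proof.
move=> xp yp f.
have tv z : perp z -> tau (v ** z) = - 2%:R *: (v ** (v ** z)).
  by move=> zp; rewrite (perp_tau (perp_v zp)) // perp_uv.
have tw z : perp z -> tau (w ** z) = - 2%:R *: (v ** (w ** z)).
  by move=> zp; rewrite (perp_tau (perp_w zp)) // perp_uw.
have rv z : perp z -> rho (v ** z) = 2%:R *: (v ** (w ** z)).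
  move=> zp; rewrite (perp_rho (perp_v zp)) ?perp_uv // perp_wv //.
  by lin_by K ltac:(by ring).
have rw z : perp z -> rho (w ** z) = - 2%:R *: (v ** (v ** z)).
  by move=> zp; rewrite (perp_rho (perp_w zp)) ?perp_uw // perp_ww // perp_vv.
have tD z z' : tau (z + z') = tau z + tau z'.
  by rewrite /tau !namE !(frobE frobB); lin_by K ltac:(by ring).
have rD z z' : rho (z + z') = rho z + rho z'.
  by rewrite /rho !namE !(frobE frobB); lin_by K ltac:(by ring).
rewrite /f tD rD (tauM (v ** x)) (tauM (w ** x)) (rhoM (v ** x)) (rhoM (w ** x)).
rewrite !tv // !tw // !rv // !rw // !namE.
by lin_by K ltac:(by ring).
Qed.

Lemma defect_perp x y : perp x -> perp y -> defect B x y v w = 0.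
Proof.
move=> xp yp; have := tau_rho_anti xp yp.
set f := _ + _ => /= fe.
have Buf : B u f = 0.
  rewrite (BC u) (frobE frobB) !BM !(namulC _ u) perp_uv // perp_uw //.
  by rewrite !namE perp_wv // !(frobE frobB); field.
have quarter_w : w ** (v ** (v ** x)) = (2%:R^-1 * 2%:R^-1) *: (w ** x).
  by rewrite (perp_wv (perp_v xp)) (perp_wv xp) namulNr opprK perp_vvw.
have Bvf : B v f = 2%:R^-1 * B y (w ** x).
  rewrite (BC v) (frobE frobB) !BM !(namulC _ v) quarter_w perp_vvw //.
  by rewrite !(frobE frobB); field.
have Bwf : B w f = 2%:R^-1 * B y (v ** x).
  rewrite (BC w) (frobE frobB) !BM !(namulC _ w) (perp_ww (perp_v xp)).
  rewrite -(perp_vv (perp_v xp)) (perp_ww xp) -(perp_vv xp) perp_vvv //.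
  by rewrite !(frobE frobB); field.
have fD : f = (v ** x) ** (w ** y) + (w ** x) ** (v ** y) by [].
clearbody f; pose z := f - (2%:R^-1 * B v f) *: v - (2%:R^-1 * B w f) *: w.
have zp : perp z.
  split; rewrite /z !(frobE frobB) ?Buf ?Buv ?Buw ?Bvv ?Bww ?(BC w v) ?Bvw;
  by field.
(* [tau] fixes [v] and negates [w], [rho] does the opposite, so subtracting multiples of [v] and [w]
   from [f] preserves [tau f + rho f = 0]. *)
have z0 : z = 0.
  apply: (perp_tau_rho zp); rewrite -[RHS]fe /tau /rho /z !namE !(frobE frobB).
  rewrite (namulC w v) uv uw vv ww vw Buv Buw Bvv Bww Bvw (BC w v) Bvw.
  by lin_by K ltac:(by field).
have fE : f = (2%:R^-1 * B v f) *: v + (2%:R^-1 * B w f) *: w.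
  by rewrite -[LHS]subr0 -z0 /z; lin_by K ltac:(by ring).
have -> : defect B x y v w
    = 2%:R^-1 *: (B v (x ** y) *: w + B w (x ** y) *: v) - 2%:R *: f.
  case: xp yp => _ vx wx [_ vy wy]; rewrite /defect vw vx wx vy wy fD !namE.
  by lin_by K ltac:(by ring).
rewrite {}Bvf {}Bwf in fE.
rewrite fE (BC v) (BC w) !BM !(namulC x); lin_by K ltac:(by field).
Qed.

(** The defect vanishes if an argument is [u], [v] or [w], so both arguments may be projected to the
    orthogonal complement. *)
Lemma defect_orthogonal x y : defect B x y v w = 0.
Proof.
pose proj z := z - (2%:R^-1 * B u z) *: u - (2%:R^-1 * B v z) *: v
  - (2%:R^-1 * B w z) *: w.
have projP z : perp (proj z).
  split; rewrite /proj !(frobE frobB) ?Buu ?Bvv ?Bww ?Buv ?Buw ?Bvw;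
  by rewrite ?(BC v u) ?(BC w u) ?(BC w v) ?Buv ?Buw ?Bvw; field.
have projE z : z = proj z + (2%:R^-1 * B u z) *: u + (2%:R^-1 * B v z) *: v
  + (2%:R^-1 * B w z) *: w by rewrite /proj; lin_by K ltac:(by ring).
have reduce z t : defect B z t v w = defect B (proj z) t v w.
  rewrite {1}[z]projE !defectD !defectZ defect_u defect_v defect_w.
  by rewrite !scaler0 !addr0.
by rewrite reduce defect_sym reduce defect_perp.
Qed.

End Orthogonal.

Section Pair.
Variables (a b : A) (aP : primitive_axis a) (bP : primitive_axis b).
Local Notation al := (B a b).
Local Notation p := (2%:R^-1 * (B a b - 1)).
Local Notation s := (sigma a b).

(* For [al = 1/2] the algebra generated by [a] and [b] has the unit
   [u = - 4 s], and [v], [w] are orthogonal vectors with [v v = w w = u]. *)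
Lemma defect_conic_half (t1 t2 : A) (x y z : K) : 2%:R * al = 1 -> conic p x y z ->
  defect B t1 t2 (combination a b x y z) (combination a b x y z) = 0.
Proof.
move=> al2; have alE : al = 2%:R^-1.
  by rewrite -[LHS](mulKf two_neq0) al2 mulr1.
have aF := frob_axis frobB aP; have bF := frob_axis frobB bP.
pose u := - 4%:R *: s; pose v := 2%:R *: a + 4%:R *: s.
pose w := 2%:R *: b + 4%:R *: s.
have ss := pair_ss two_neq0 frobB aP bP; rewrite alE in ss.
have as_ := pair_as frobB b aP; rewrite alE in as_.
have bs := pair_bs frobB a bP; rewrite alE in bs.
have ab := pair_ab a b; have aa := axis_idemp aF; have bb := axis_idemp bF.
have ba : b ** a = s + 2%:R^-1 *: a + 2%:R^-1 *: b by rewrite namulC.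
have sa : s ** a = (2%:R^-1 * (2%:R^-1 - 1)) *: a by rewrite namulC.
have sb : s ** b = (2%:R^-1 * (2%:R^-1 - 1)) *: b by rewrite namulC.
have Bas := frob_as two_neq0 frobB b aP; rewrite alE in Bas.
have Bbs := frob_bs two_neq0 frobB a bP; rewrite alE in Bbs.
have Bss := frob_ss two_neq0 frobB aP bP; rewrite alE in Bss.
have Baa := frob_axis1 two_neq0 frobB aP; have Bbb := frob_axis1 two_neq0 frobB bP.
have Bba : B b a = 2%:R^-1 by rewrite frobC.
have Bsa : B s a = 2%:R^-1 * (2%:R^-1 - 1) by rewrite frobC.
have Bsb : B s b = 2%:R^-1 * (2%:R^-1 - 1) by rewrite frobC.
have prodE := (aa, bb, ss, ab, ba, as_, sa, bs, sb).
have bE := (Baa, Bbb, Bss, alE, Bba, Bas, Bsa, Bbs, Bsb).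
have al4 : 4%:R * al != 1.
  rewrite alE (natrM _ 2 2) mulfK // -subr_eq0.
  by rewrite (_ : 2%:R - 1 = 1) ?oner_eq0 //; ring.
have e0 : defect B t1 t2 v w = 0.
  have pv r : [/\ peirce B r u v = 0, peirce B r u w = 0, peirce B r v w = 0,
      peirce B r u u + peirce B r v v = 0 & peirce B r u u + peirce B r w w = 0].
    have qB := peirce_bilinear frobB r.
    have pab := peirce_as two_neq0 frobB b aP r.
    have pbs := peirce_bs two_neq0 frobB aP bP r.
    have pss := peirce_ss two_neq0 frobB aP bP r; rewrite alE in pss.
    have paa := peirce_axis two_neq0 frobB r aP.
    have pbb := peirce_axis two_neq0 frobB r bP.
    split; rewrite /u /v /w !(bilE qB) ?(bilC qB s a) ?(bilC qB s b) ?(bilC qB b a);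
    rewrite ?pss ?pbs ?pab ?paa ?pbb ?pbs; by lin_by K ltac:(by field).
  have cs := sigma_comm two_neq0 b _ aF.
  have cs' r : b ** (s ** r) = s ** (b ** r).
    by rewrite sigmaC (sigma_comm two_neq0 a r bF).
  have aE : 2%:R^-1 *: (u + v) = a by rewrite /u /v; lin_by K ltac:(by field).
  have bE' : 2%:R^-1 *: (u + w) = b by rewrite /u /w; lin_by K ltac:(by field).
  apply: (@defect_orthogonal u v w); rewrite ?aE ?bE' //;
    try by [move=> r; case: (pv r) | rewrite /u /v /w !(namE, prodE);
      lin_by K ltac:(by field) | rewrite /u /v /w !(frobE frobB, bE); field
     | move=> r; rewrite /u /v /w !namE ?cs ?cs'; lin_by K ltac:(by field)].
have qD := defect_bilinear frobB t1 t2.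
have qP c := @defect_axis _ _ two_neq0 _ frobB t1 t2 c.
have e1 := bilinear_as_bs two_neq0 frobB aP bP qD qP al4.
have e2 := bilinear_ss two_neq0 frobB aP bP qD qP al4.
apply: (bilinear_conic two_neq0 qD (qP _ aP) (qP _ bP)) => //.
(* With [r = q a s], the expansion of [q v w = 0] is [4 q a b + 8 r = 0], the missing value of
   [q a b]. *)
move: e0; rewrite /v /w !(bilE qD) (bilC qD s b) e2 -e1 alE => e0.
rewrite -[LHS]subr0 -(scaler0 _ (2%:R^-1 * 2%:R^-1)) -e0.
by lin_by K ltac:(by field).
Qed.

End Pair.
End Half.

(** * Idempotents of the subalgebra *)

Section Idempotents.
Variables (K : fieldType) (A : commNAAlgType K).
Hypothesis two_neq0 : (2%:R : K) != 0.
Variables (B : A -> A -> K) (frobB : frobenius_form B).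
Variables (a b : A) (aP : primitive_axis a) (bP : primitive_axis b).
Implicit Types (x y z k l m n : K) (c d : A).
Local Notation al := (B a b).
Local Notation p := (2%:R^-1 * (B a b - 1)).
Local Notation s := (sigma a b).

Lemma mul_combination x y z x' y' z' :
  combination a b x y z ** combination a b x' y' z'
  = combination a b
      (x * x' + 2%:R^-1 * (x * y' + y * x') + p * (x * z' + z * x'))
      (y * y' + 2%:R^-1 * (x * y' + y * x') + p * (y * z' + z * y'))
      (x * y' + y * x' + p * z * z').
Proof.
rewrite /combination !namE (axis_idemp (frob_axis frobB aP)).
rewrite (axis_idemp (frob_axis frobB bP)) (namulC b a) pair_ab (namulC s a).
rewrite (namulC s b) (pair_as frobB b aP) (pair_bs frobB a bP).
rewrite (pair_ss two_neq0 frobB aP bP).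
by lin_by K ltac:(by field).
Qed.

(** Pair the relation with [a], [b] and [s]. If [p] is nonzero, either all coefficients vanish or
    [al = 0] and the relation is a nonzero multiple of [ab]. If [p = 0], multiplying by [a] and by
    [b] and adding gives a multiple of [a - b]. *)
Lemma combination_free l m n : a <> b -> a ** b <> 0 -> s <> 0 ->
  combination a b l m n = 0 -> [/\ l = 0, m = 0 & n = 0].
Proof.
move=> nab ab0 s0 e.
have ea : l + m * al + n * p = 0.
  have := congr1 (B a) e; rewrite /combination !(frobE frobB).
  by rewrite (frob_axis1 two_neq0 frobB aP) (frob_as two_neq0 frobB b aP) mulr1.
have eb : l * al + m + n * p = 0.
  have := congr1 (B b) e; rewrite /combination !(frobE frobB) (frobC frobB b a).
  by rewrite (frob_axis1 two_neq0 frobB bP) (frob_bs two_neq0 frobB a bP) mulr1.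
have es : p * (l + m + 2%:R * p * n) = 0.
  have := congr1 (B s) e; rewrite /combination !(frobE frobB).
  rewrite (frob_ss two_neq0 frobB aP bP) !(frobC frobB s).
  rewrite (frob_as two_neq0 frobB b aP) (frob_bs two_neq0 frobB a bP) => <-.
  by ring.
have lm : p * (l - m) = 0.
  rewrite -[RHS](mulr0 (- 2%:R^-1)) -[X in _ = _ * X](subrr 0) -{1}ea -eb.
  by ring.
have [p0|p0] := eqVneq p 0.
  have al1 : al = 1.
    by have -> : al = 2%:R * p + 1 by [field]; rewrite p0; ring.
  move: ea; rewrite p0 al1 mulr0 addr0 mulr1 => /eqP; rewrite addr_eq0 => /eqP le.
  have [m0|m0] := eqVneq m 0.
    move: le e; rewrite m0 oppr0 => l0; rewrite l0 /combination !scale0r !add0r.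
    move=> /eqP; rewrite scaler_eq0 => /orP[/eqP //|/eqP //].
  case: nab; have := congr1 (namul a) e; have := congr1 (namul b) e.
  rewrite /combination !namE (pair_as frobB b aP) (pair_bs frobB a bP) p0.
  rewrite (axis_idemp (frob_axis frobB aP)) (axis_idemp (frob_axis frobB bP)).
  rewrite (namulC b a) pair_ab le => e1 e2.
  have : m *: (a - b) = 0.
    have := congr2 +%R e1 e2; rewrite addr0 => e3; rewrite -[RHS]oppr0 -e3.
    by lin_by K ltac:(by field).
  by move=> /(scale_eq0 m0)/eqP; rewrite subr_eq0 => /eqP.
move: lm es => /eqP; rewrite mulf_eq0 (negPf p0) subr_eq0 => /eqP lm.
move=> /eqP; rewrite mulf_eq0 (negPf p0) -lm => /eqP es.
have np : n * p = - l.
  apply: (mulfI two_neq0); rewrite -[RHS]addr0 -es; ring.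
move: ea; rewrite -lm np addrAC subrr add0r => /eqP; rewrite mulf_eq0.
have [l0 _|l0 /= /eqP al0] := eqVneq l 0.
  split=> //; apply/eqP; move/eqP: np; rewrite l0 oppr0 mulf_eq0 (negPf p0).
  by rewrite orbF.
have n2 : n = 2%:R * l.
  have -> : l = - (n * p) by rewrite np opprK.
  by rewrite al0; field.
case: ab0; rewrite pair_ab; apply: (@scale_eq0 _ _ (2%:R * l)).
  by rewrite mulf_neq0.
by rewrite -[RHS]e /combination -lm n2; lin_by K ltac:(by field).
Qed.

(* The degenerate cases [ab = 0] and [s = 0], where [a], [b], [s] are linearly
   dependent, are treated separately; in the latter [z] may be chosen freely. *)
Lemma idempotent_on_conic c x y z : a <> b -> c = combination a b x y z ->
    c != 0 -> c ** c = c ->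
    (forall d, d = a \/ d = b -> c ** d = d -> exists k, d = k *: c) ->
  [\/ c = a, c = b |
      exists x' y' z', c = combination a b x' y' z' /\ on_conic p x' y' z'].
Proof.
move=> nab cE c0 cc prim.
have a0 := axis_nz (frob_axis frobB aP); have b0 := axis_nz (frob_axis frobB bP).
have aa := axis_idemp (frob_axis frobB aP).
have bb := axis_idemp (frob_axis frobB bP).
have [ab0|ab0] := pselect (a ** b = 0).
  have {}cE : c = (x - 2%:R^-1 * z) *: a + (y - 2%:R^-1 * z) *: b.
    by rewrite cE /combination sigmaE ab0; lin_by K ltac:(by field).
  move: (x - _) (y - _) cE => {x y z} x y cE.
  have ca : c ** a = x *: a.
    by rewrite cE !namE aa (namulC b) ab0; lin_by K ltac:(by ring).
  have cb : c ** b = y *: b by rewrite cE !namE bb ab0; lin_by K ltac:(by ring).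
  have cc' : (x * x) *: a + (y * y) *: b = x *: a + y *: b.
    by rewrite -[RHS]cE -cc {2}cE !namE ca cb !scalerA.
  have idem k : k * k = k -> k = 0 \/ k = 1.
    move=> /eqP; rewrite -subr_eq0 -{3}[k]mulr1 -mulrBr mulf_eq0 subr_eq0.
    by case/orP=> /eqP ->; [left|right].
  have xx : x * x = x.
    apply: (scaler_inj_axis a0); have := congr1 (namul a) cc'.
    by rewrite !namE aa ab0 !scaler0 !addr0.
  have yy : y * y = y.
    apply: (scaler_inj_axis b0); have := congr1 (namul b) cc'.
    by rewrite !namE bb (namulC b) ab0 !scaler0 !add0r.
  case: (idem _ xx) => x1; case: (idem _ yy) => y1; move: cE; rewrite x1 y1.
  - by rewrite !scale0r addr0 => cE; rewrite cE eqxx in c0.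
  - by rewrite scale0r add0r scale1r; constructor 2.
  - by rewrite scale0r addr0 scale1r; constructor 1.
  (* The remaining candidate [a + b] fixes [a], which is not a multiple of it. *)
  have ca' : c ** a = a by rewrite ca x1 scale1r.
  have [k aE] := prim a (or_introl erefl) ca'; move=> _; case/eqP: a0.
  have k0 : k = 0.
    apply: (scaler_inj_axis b0); have := congr1 (namul b) aE.
    by rewrite namE (namulC b a) ab0 (namulC b c) cb y1 scale1r scale0r => <-.
  by rewrite aE k0 scale0r.
have [s0|s0] := pselect (s = 0).
  (* Here [p = 0] and [x + y = 1], so the conic reads [z = 2 x y]. *)
  apply: Or33; exists x, y, (2%:R * x * y).
  have p0 : p = 0.
    have := pair_as frobB b aP; rewrite s0 namE => /esym/eqP.
    by rewrite scaler_eq0 (negPf a0) orbF => /eqP.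
  have xy1 : x + y = 1.
    apply: (scaler_inj_axis c0); rewrite scale1r -[RHS]cc cE mul_combination.
    by rewrite /combination s0 p0; lin_by K ltac:(by field).
  split; first by rewrite cE /combination s0 !scaler0.
  by split; rewrite ?/conic p0 ?xy1; ring.
have free := fun l m n => @combination_free l m n nab ab0 s0.
(* The coefficients of [cc - c]. *)
have [] := free (x * (x + y + 2%:R * p * z - 1)) (y * (x + y + 2%:R * p * z - 1))
    (2%:R * x * y + p * z * z - z).
  rewrite -[RHS](subrr c) -{1}cc cE mul_combination /combination.
  by lin_by K ltac:(by field).
set t := x + y + _; have [t1 _ _ e|t1] := eqVneq t 1.
  apply: Or33; exists x, y, z; split=> //; split=> //; rewrite /conic.
  move/eqP: e; rewrite subr_eq0 => /eqP e.
  have zt : z = z * t by rewrite t1 mulr1.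
  by rewrite -[LHS](addrK (p * z * z)) e {1}zt /t; ring.
rewrite -subr_eq0 in t1; move=> /eqP; rewrite mulf_eq0 (negPf t1) orbF => /eqP x0.
move=> /eqP; rewrite mulf_eq0 (negPf t1) orbF => /eqP y0.
rewrite x0 mulr0 mul0r add0r => /eqP; rewrite subr_eq0 => /eqP pz.
(* Off the linear condition only [s / p] is left; it fixes [a], contrary to [prim]. *)
have cE' : c = z *: s by rewrite cE /combination x0 y0 !scale0r !add0r.
have z0 : z != 0 by apply: contra_neq c0 => z0; rewrite cE' z0 scale0r.
have pz1 : p * z = 1 by apply: (mulIf z0); rewrite pz mul1r.
have ca : c ** a = a.
  by rewrite cE' namE namulC (pair_as frobB b aP) scalerA mulrC pz1 scale1r.
have [k aE] := prim a (or_introl erefl) ca.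
have [] := free 1 0 (- (k * z)).
  by rewrite /combination {1}aE cE'; lin_by K ltac:(by ring).
by move=> /eqP; rewrite oner_eq0.
Qed.

End Idempotents.

(** * Extension of scalars *)

Section ScalarExtensionAxes.
Variables (F E : fieldType) (iota : {rmorphism F -> E}) (A : commNAAlgType F).
Hypothesis two_neq0 : (2%:R : F) != 0.
Implicit Types (x y a b c : A) (k : F) (e : E).

Definition scalar_embed x : scalar_ext iota A := tensor iota x 1.
Local Notation T := scalar_embed.

Lemma tensorE x e : tensor iota x e = e *: T x.
Proof. by rewrite [RHS]ext_scaleE /scale_sum /= mulr1. Qed.

Lemma scalar_embedD x y : T (x + y) = T x + T y.
Proof. by rewrite [RHS]ext_addE; apply/formal_sumP; exact: tensor_addl. Qed.

Lemma scalar_embedZ k x : T (k *: x) = iota k *: T x.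
Proof. by rewrite -tensorE -[iota k]mulr1; apply/formal_sumP; exact: tensor_scale. Qed.

Lemma scalar_embedN x : T (- x) = - T x.
Proof. by rewrite -scaleN1r scalar_embedZ rmorphN1 scaleN1r. Qed.

Lemma scalar_embed0 : T 0 = 0.
Proof. by rewrite -(scale0r (0 : A)) scalar_embedZ rmorph0 scale0r. Qed.

Lemma scalar_embedM x y : T (x ** y) = T x ** T y.
Proof. by rewrite [RHS]mul_tensor mulr1. Qed.

Definition embedE :=
  (scalar_embedD, scalar_embedZ, scalar_embedN, scalar_embed0, scalar_embedM).

Lemma scalar_embed_ind (P : scalar_ext iota A -> Prop) :
    (forall u v, P u -> P v -> P (u + v)) -> (forall e u, P u -> P (e *: u)) ->
    (forall x, P (T x)) ->
  forall u, P u.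
Proof.
move=> PD PZ PT u; have [s ->] := scalar_extP u.
elim: s => [|p s IHs]; first by rewrite big_nil -scalar_embed0.
by rewrite big_cons; apply: PD => //; apply: PZ; exact: PT.
Qed.

Lemma two_neq0_ext : (2%:R : E) != 0.
Proof. by rewrite -(rmorph_nat iota) fmorph_eq0. Qed.

(** The conditions in [axis_form] are identities linear in each variable, so they extend from the
    embedded elements to all of the scalar extension. *)
Lemma scalar_embed_axis c f : axis_form c f ->
  exists2 g, axis_form (T c) g & forall x, g (T x) = iota (f x).
Proof.
move=> cf; have fL := axis_linear cf.
have [|k x|g gE] := @scalar_ext_lift F E iota A E^o (fun x => iota (f x)).
- by move=> x y; rewrite (formD fL) rmorphD.
- by rewrite (formZ fL) rmorphM.
have gT x : g (T x) = iota (f x) by rewrite gE scale1r.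
have gL : @linear_form E (scalar_ext iota A) g.
  by split=> [u v|e u]; rewrite ?linearD ?linearZ.
have iE := (@rmorph_nat _ _ iota, @fmorphV _ _ iota, @rmorphM _ _ iota,
  @rmorphN _ _ iota, @rmorphD _ _ iota).
exists g => //; split=> //.
- apply/eqP => c0; have := gT c; rewrite c0 (form0 gL) (axis_form1 two_neq0 cf).
  by rewrite rmorph1 => /esym/eqP; rewrite oner_eq0.
- by rewrite -scalar_embedM (axis_idemp cf).
- elim/scalar_embed_ind=> [u v eu ev|e u eu|x].
  + by rewrite !namE eu ev (formD gL); lin_by E ltac:(by ring).
  + by rewrite !namE eu (formZ gL); lin_by E ltac:(by ring).
  + by rewrite -!scalar_embedM (axis_peirce cf) !embedE gT !iE.
- elim/scalar_embed_ind=> [u u' eu eu'|e u eu|x] v.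
  + by rewrite !namE eu eu' !(formE gL); lin_by E ltac:(by ring).
  + by rewrite !namE eu !(formE gL); lin_by E ltac:(by ring).
  elim/scalar_embed_ind: v => [u u' eu eu'|e u eu|y].
  + by rewrite !namE eu eu' !(formE gL); lin_by E ltac:(by ring).
  + by rewrite !namE eu !(formE gL); lin_by E ltac:(by ring).
  + by rewrite -!scalar_embedM (axis_fusion cf) !gT !embedE !iE.
- elim/scalar_embed_ind=> [u u' eu eu'|e u eu|x] v.
  + by rewrite !namE !(formE gL) addrACA eu eu'; ring.
  + by rewrite !namE !(formE gL) -mulrDr eu; ring.
  elim/scalar_embed_ind: v => [u u' eu eu'|e u eu|y].
  + by rewrite !namE !(formE gL) addrACA eu eu'; ring.
  + by rewrite !namE !(formE gL) -mulrDr eu; ring.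
  + by rewrite -!scalar_embedM !gT -rmorphD (axis_assoc cf) rmorphD rmorphM.
Qed.

Lemma scalar_embed_primitive c : primitive_axis c -> primitive_axis (T c).
Proof.
move=> /(primitive_axis_form two_neq0)[f cf].
have [g cg _] := scalar_embed_axis cf.
exact: (axis_form_primitive two_neq0_ext cg).
Qed.

Lemma scalar_ext_spanned : spanned_by_axes A -> spanned_by_axes (scalar_ext iota A).
Proof.
move=> spanA; apply: scalar_embed_ind => [||x].
- exact: axis_spanD.
- exact: axis_spanZ.
elim/(@spanned_ind _ _ spanA): x => [x y ex ey|k x ex||c cP]; rewrite ?embedE.
- exact: axis_spanD.
- exact: axis_spanZ.
- exact: axis_span0.
- exact/axis_span_axis/scalar_embed_primitive.
Qed.

Lemma scalar_embed_combination a b (x y z : F) :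
  T (combination a b x y z) = combination (T a) (T b) (iota x) (iota y) (iota z).
Proof.
by rewrite /combination !sigmaE !embedE !(fmorphV iota) !(rmorph_nat iota).
Qed.

Lemma scalar_embed_form (B : A -> A -> F)
    (BE : scalar_ext iota A -> scalar_ext iota A -> E) a b :
    frobenius_form B -> frobenius_form BE -> primitive_axis a ->
  BE (T a) (T b) = iota (B a b).
Proof.
move=> BF BEF aP; have [g ag <-] := scalar_embed_axis (frob_axis BF aP).
exact: (axis_form_uniq two_neq0_ext (frob_axis BEF (scalar_embed_primitive aP)) ag).
Qed.

End ScalarExtensionAxes.

(** * Solidity when the form value is not 1/4 or a fourth axis exists *)

Section Solid.
Variables (F : fieldType) (A : commNAAlgType F).
Hypothesis two_neq0 : (2%:R : F) != 0.
Variables (B : A -> A -> F) (frobB : frobenius_form B).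
Variables (a b : A) (aP : primitive_axis a) (bP : primitive_axis b).
Local Notation al := (B a b).
Local Notation p := (2%:R^-1 * (B a b - 1)).

(* On the conic, [z = 0] gives [a] and [b], and if [B a b = 1/4] then
   [x = y = -1] gives the reflection of [a] in [b]. *)
Definition extra_axis := exists x y z, [/\ primitive_axis (combination a b x y z),
  on_conic p x y z, z != 0 & ~ (x = -1 /\ y = -1)].

Lemma conic_axis x y z : 4%:R * al != 1 \/ extra_axis -> conic p x y z ->
    let c := combination a b x y z in c != 0 -> c ** c = c ->
  primitive_axis c.
Proof.
move=> h cc c c0 cid; apply: (axis_form_primitive two_neq0).
apply: (idempotent_axis two_neq0 frobB c0 cid) => [t|t u].
  exact: peirce_conic.
have [al4|al4] := eqVneq (4%:R * al) 1.
  case: h => [/eqP//|[x0 [y0 [z0 [cP cc0 z00 nxy]]]]].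
  exact: (defect_conic_quarter two_neq0 frobB aP bP al4 t u cP cc0 z00 nxy cc).
have [al2|al2] := eqVneq (2%:R * al) 1; first exact: defect_conic_half.
exact: defect_conic.
Qed.

Lemma generated_combination c : generated [set a; b] c ->
  exists x y z, c = combination a b x y z.
Proof.
move: c; apply: (@smallest_sub _ _ _
  [set c | exists x y z, c = combination a b x y z]) => /=.
  split.
  - by exists 0, 0, 0; rewrite /combination !scale0r !addr0.
  - move=> _ _ [x [y [z ->]]] [x' [y' [z' ->]]].
    exists (x + x'), (y + y'), (z + z').
    by rewrite /combination; lin_by F ltac:(by ring).
  - move=> k _ [x [y [z ->]]]; exists (k * x), (k * y), (k * z).
    by rewrite /combination; lin_by F ltac:(by ring).
  - move=> _ _ [x [y [z ->]]] [x' [y' [z' ->]]].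
    rewrite (mul_combination two_neq0 frobB aP bP); eexists _, _, _; reflexivity.
move=> _ [] ->; [exists 1, 0, 0|exists 0, 1, 0];
  by rewrite /combination; lin_by F ltac:(by ring).
Qed.

End Solid.

(** The conic, the form value and a possible extra axis all pass to the scalar extension, where
    [conic_axis] applies to every primitive idempotent. *)
Lemma solid_generated (F : fieldType) (A : commNAAlgType F)
    (two_neq0 : (2%:R : F) != 0) (B : A -> A -> F) (a b : A) :
    spanned_by_axes A -> frobenius_form B ->
    primitive_axis a -> primitive_axis b ->
    4%:R * B a b != 1 \/ extra_axis B a b ->
  solid (generated [set a; b]).
Proof.
move=> spanA BF aP bP h E iota _ c [[s [sP cE]] c0 cc prim].
have two_neq0E := two_neq0_ext iota two_neq0.
have spanE : spanned_by_axes (scalar_ext iota A).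
  exact: scalar_ext_spanned.
have [BE BEF] := frobenius_form_exists two_neq0E spanE.
have TaP := scalar_embed_primitive iota two_neq0 aP.
have TbP := scalar_embed_primitive iota two_neq0 bP.
have alE := scalar_embed_form two_neq0 b BF BEF aP.
have [x [y [z {}cE]]] : exists x y z,
    c = combination (scalar_embed iota a) (scalar_embed iota b) x y z.
  rewrite {}cE; elim: s sP => [|q s IHs] sP.
    by exists 0, 0, 0; rewrite big_nil /combination !scale0r !addr0.
  have [r|x' [y' [z' eq1]]] := IHs; first by move=> rs; apply: sP; rewrite inE rs orbT.
  have [x [y [z eq2]]] :=
    generated_combination two_neq0 BF aP bP (sP q (mem_head _ _)).
  exists (q.2 * iota x + x'), (q.2 * iota y + y'), (q.2 * iota z + z').
  rewrite big_cons eq1 tensorE eq2 scalar_embed_combination /combination.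
  by lin_by (GRing.Field.sort E) ltac:(by ring).
have Tgen d : generated [set a; b] d ->
    ext_subalgebra iota (generated [set a; b]) (scalar_embed iota d).
  move=> dg; exists [:: (d, 1)]; rewrite big_seq1; split=> // q.
  by rewrite inE => /eqP ->.
have cprim d : d = scalar_embed iota a \/ d = scalar_embed iota b ->
    c ** d = d -> exists k, d = k *: c.
  move=> dE cd; suff : line c d by [].
  rewrite -prim; split=> //; case: dE => ->; apply: Tgen => D [_]; apply.
    by left.
  by right.
suff: primitive_axis c by case.
(* If the images coincide, [c] is an idempotent multiple of the image of [a], hence equal to it. *)
have [Tab|Tab] := pselect (scalar_embed iota a = scalar_embed iota b).
  have Taa := axis_idemp (frob_axis BEF TaP).
  have cTa : c = (x + y) *: scalar_embed iota a.
    rewrite cE /combination sigmaE -Tab Taa; lin_by (GRing.Field.sort E) ltac:(by field).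
  have xy1 : x + y = 1.
    apply: (scaler_inj_axis c0); rewrite scale1r -[RHS]cc {2}cTa namE.
    by rewrite {2}cTa namulC namE Taa -cTa.
  by rewrite cTa xy1 scale1r.
have [-> //|-> //|[x' [y' [z' [cE' [cc' _]]]]]] :=
  idempotent_on_conic two_neq0E BEF TaP TbP Tab cE c0 cc cprim.
rewrite cE' in c0 cc *.
apply: (conic_axis two_neq0E BEF TaP TbP _ cc') => //.
rewrite alE; case: h => [al4|[x0 [y0 [z0 [cP [k0 t0] z00 nxy]]]]].
  left; have -> : 4%:R * iota (B a b) = iota (4%:R * B a b).
    by rewrite rmorphM rmorph_nat.
  by rewrite fmorph_eq1.
right; exists (iota x0), (iota y0), (iota z0).
rewrite -scalar_embed_combination fmorph_eq0 alE.
have pE : 2%:R^-1 * (iota (B a b) - 1) = iota (2%:R^-1 * (B a b - 1)).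
  by rewrite rmorphM fmorphV rmorph_nat rmorphB rmorph1.
split=> //.
- exact: scalar_embed_primitive.
- rewrite pE; split.
    rewrite /conic -!(rmorph_nat iota) -!(rmorphM iota) -!(rmorphD iota).
    by rewrite -!(rmorphM iota) -!(rmorphD iota) -k0.
  move: (2%:R^-1 * _) t0 => r /(congr1 iota); rewrite rmorph1 => e.
  by rewrite -[RHS]e !rmorphD !(rmorphM iota) rmorph_nat.
- move=> [xE yE]; apply: nxy; split; apply: (fmorph_inj iota);
  by rewrite ?xE ?yE rmorphN1.
Qed.

(** * Counting the axes *)

(** The span of the axes is closed under products: [pq] is a combination of [p], [q] and the image
    of [q] under the involution of [p], again an axis. *)
Lemma spanned_primitive_axial_algebra (F : fieldType) (A : commNAAlgType F)
    (X : set A) :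
  (2%:R : F) != 0 -> primitive_axial_algebra X -> spanned_by_axes A.
Proof.
move=> two_neq0 [XP Xgen] x; have : generated X x by rewrite Xgen.
move: x; apply: smallest_sub => [|c /XP cP]; last first.
  exact: axis_span_axis.
split; [exact: axis_span0|exact: axis_spanD|exact: axis_spanZ|].
move=> x y [s [sP ->]] [t [tP ->]].
elim: s sP => [|p s IHs] sP; first by rewrite big_nil namul0l; exact: axis_span0.
rewrite big_cons namulDl; apply: axis_spanD; last first.
  by apply: IHs => q qs; apply: sP; rewrite inE qs orbT.
rewrite namulZl; apply: axis_spanZ; have {}sP := sP p (mem_head _ _).
elim: t tP {s IHs} => [|q t IHt] tP; first by rewrite big_nil namul0r; exact: axis_span0.
rewrite big_cons namulDr; apply: axis_spanD; last first.
  by apply: IHt => r rt; apply: tP; rewrite inE rt orbT.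
rewrite namulZr; apply: axis_spanZ; have {}tP := tP q (mem_head _ _).
have [f pf] := primitive_axis_form two_neq0 sP.
have [g qg] := primitive_axis_form two_neq0 tP.
have mP : primitive_axis (miyamoto p.2 f q.2).
  apply: (axis_form_primitive two_neq0).
  exact: (axis_form_aut (miyamotoD pf) (miyamotoZ pf) (miyamotoM two_neq0 pf)
    (miyamotoK two_neq0 pf) qg).
have -> : p.2 ** q.2 = (2%:R^-1 * 2%:R^-1) *: q.2
    + (f q.2 *: p.2 + (- (2%:R^-1 * 2%:R^-1)) *: miyamoto p.2 f q.2).
  by rewrite /miyamoto; lin_by F ltac:(by field).
by apply: axis_spanD; [|apply: axis_spanD]; apply: axis_spanZ;
  apply: axis_span_axis.
Qed.

Theorem mainTheorem4 (F : fieldType) (charF : 2%N \notin [pchar F])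
    (A : commNAAlgType F) (X : set A) (hX : primitive_axial_algebra X)
    (a b : A) (ha : X a) (hb : X b) (hab : a <> b)
    (hsolid : ~ solid (generated [set a; b])) :
  [set c : A | generated [set a; b] c /\ primitive_axis c] #= `I_3.
Proof.
have two_neq0 : (2%:R : F) != 0 by apply: contraNneq charF => /eqP; rewrite inE.
have spanA := spanned_primitive_axial_algebra two_neq0 hX.
have [B BF] := frobenius_form_exists two_neq0 spanA.
have aP := proj1 hX _ ha; have bP := proj1 hX _ hb.
have [al4|al4] := eqVneq (4%:R * B a b) 1; last first.
  by case: hsolid; apply: (solid_generated two_neq0 spanA BF aP bP); left.
have bF := frob_axis BF bP; have aF := frob_axis BF aP.
have rP := reflected_axis two_neq0 BF aP bP.
have rE : reflected B a b = combination a b (-1) (-1) (- 4%:R).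
  by rewrite /reflected /combination al4; lin_by F ltac:(by ring).
have rb : reflected B a b <> b.
  rewrite -(miyamoto_axis two_neq0 BF) => /(congr1 (miyamoto b (B b))).
  by rewrite (miyamotoK two_neq0 bF) (miyamoto_self two_neq0 BF).
have ra : reflected B a b <> a.
  (* At 1/4 the reflections of [a] in [b] and of [b] in [a] coincide. *)
  have <- : reflected B b a = reflected B a b.
    rewrite /reflected (frobC BF b) al4 sigmaC; lin_by F ltac:(by ring).
  rewrite -(miyamoto_axis two_neq0 BF) => /(congr1 (miyamoto a (B a))).
  by rewrite (miyamotoK two_neq0 aF) (miyamoto_self two_neq0 BF) // => /esym.
have ga : generated [set a; b] a by move=> D [_]; apply; left.
have gb : generated [set a; b] b by move=> D [_]; apply; right.
have gr : generated [set a; b] (reflected B a b).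
  move=> D [[D0 DD DZ DM] DX]; have Da : D a by apply: DX; left.
  have Db : D b by apply: DX; right.
  have -> : reflected B a b = 1 *: a + (1 *: b + (- 4%:R) *: (a ** b)).
    by rewrite rE /combination sigmaE; lin_by F ltac:(by field).
  by apply: (DD); [|apply: (DD)]; apply: (DZ) => //; apply: DM.
have three c : generated [set a; b] c -> primitive_axis c ->
    [\/ c = a, c = b | c = reflected B a b].
  move=> cg cP; have cF := frob_axis BF cP.
  have [x [y [z cE]]] := generated_combination two_neq0 BF aP bP cg.
  have cprim d : d = a \/ d = b -> c ** d = d -> exists k, d = k *: c.
    move=> _ cd; suff : line c d by [].
    by case: cP => _ <-; rewrite /eigenspace_of /= scale1r.
  have [->|->|] := idempotent_on_conic two_neq0 BF aP bP hab cE (axis_nz cF)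
    (axis_idemp cF) cprim; [by constructor 1|by constructor 2|].
  move=> {x y z cE} [x [y [z [cE cc]]]].
  have [z0|z0] := eqVneq z 0.
    move: cc cE; rewrite z0 => -[]; rewrite /conic !mulr0 !addr0 => /eqP.
    rewrite -mulrA mulf_eq0 (negPf two_neq0) mulf_eq0 => /= /orP[]/eqP ->.
      rewrite add0r => -> ->; constructor 2.
      by rewrite /combination; lin_by F ltac:(by ring).
    rewrite addr0 => -> ->; constructor 1.
    by rewrite /combination; lin_by F ltac:(by ring).
  have [[x1 y1]|nxy] := pselect (x = -1 /\ y = -1).
    (* The linear condition gives [2 p z = 3], which does not determine [z] in characteristic 3,
       where [p = 0]; together with the conic it forces [z = - 4]. *)
    constructor 3; rewrite rE cE x1 y1; congr combination.
    case: cc; rewrite /conic x1 y1; move: (2%:R^-1 * _) => r e t.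
    have r3 : 2%:R * r * z = 3%:R.
      by rewrite -[LHS](addKr (-1 + -1 : F)) t; ring.
    have -> : z = - (2%:R * (-1 + -1) * z + 2%:R * r * z * z) by rewrite r3; ring.
    have -> : 2%:R * (-1 + -1) * z + 2%:R * r * z * z
      = 2%:R * ((-1 + -1) * z + r * z * z) by ring.
    by rewrite -e; ring.
  (* A fourth axis would make the subalgebra solid. *)
  case: hsolid; apply: (solid_generated two_neq0 spanA BF aP bP); right.
  by exists x, y, z; rewrite -cE.
apply/card_set_bijP.
exists (fun c => if c == a then 0%N else if c == b then 1%N else 2).
split.
- by move=> c _ /=; case: ifP => // _; case: ifP.
- move=> c d; rewrite !inE /= => -[cg cP] [dg dP].
  have nba : (b == a) = false by apply/negP => /eqP/esym.
  have nra : (reflected B a b == a) = false by apply/negP => /eqP.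
  have nrb : (reflected B a b == b) = false by apply/negP => /eqP.
  by case: (three c cg cP) => ->; case: (three d dg dP) => ->;
    rewrite ?eqxx ?nba ?nra ?nrb ?eqxx.
move=> i /=; have nba : (b == a) = false by apply/negP => /eqP/esym.
have nra : (reflected B a b == a) = false by apply/negP => /eqP.
have nrb : (reflected B a b == b) = false by apply/negP => /eqP.
case: i => [|[|[|//]]] _.
- by exists a => //; rewrite eqxx.
- by exists b => //; rewrite nba eqxx.
- by exists (reflected B a b) => //; rewrite nra nrb.
Qed.
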